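(* Consider a polytope scheduling problem with polytope $\mathcal P$ and job set $J$. Suppose that for every $\mathbf c\in\mathbb R_{+}^{|J|}$ the function $v(\mathbf x)=\max_{0\le \mathbf z\le \mathbf x,\ \mathbf z\in\mathcal P}\mathbf c\cdot\mathbf z$ is linear substitute. Then for any $\epsilon>0$, the gradient descent algorithm GD with respect to the fractional residual optimum is a $(1+\epsilon)$-speed $O(1/\epsilon)$-competitive online algorithm for minimizing total fractional weighted flow time; thus, there exists a $(1+\epsilon)$-speed $O(1/\epsilon^2)$-competitive online algorithm for total (integral) weighted flow time.
   Context: Polytope scheduling problem (PSP): a downward-closed polytope (more generally convex body) $\mathcal P\subseteq\mathbb R_{\ge 0}^{J}$, indexed by jobs and fixed over time, describes the feasible processing rates: at each time, jobs can be processed at rates $\mathbf z=(z_j)_j$ iff $\mathbf z\in\mathcal P$ (downward-closed: $0\le \mathbf z'\le\mathbf z\in\mathcal P$ implies $\mathbf z'\in\mathcal P$). Every job can be processed at some positive rate. Job $j$ arrives online at time $r_j$ with size $p_j>0$ and weight $w_j\ge 0$, revealed to the online algorithm only at time $r_j$. A schedule chooses rates $\mathbf z(t)$ (with $z_j(t)=0$ for $t<r_j$) such that each job $j$ is processed by $p_j$ units in total; preemption is free. The completion time $C_j$ is the minimum $t'$ with $\int_{r_j}^{t'}z_j(t)\,dt=p_j$. Total weighted flow time is $\sum_j w_j(C_j-r_j)$. Total fractional weighted flow time is $\sum_j \int_{r_j}^\infty \frac{w_j}{p_j}(t-r_j)z_j(t)\,dt$. Speed: an algorithm with speed $s$ may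 use rates $s\mathbf z$ with $\mathbf z\in\mathcal P$. An online algorithm is $s$-speed $c$-competitive for an objective if, on every (finite) job sequence, its objective when run with speed $s$ is at most $c$ times the minimum objective of an offline schedule with speed $1$. $O(\cdot)$ hides an absolute constant ($\epsilon$ is thought of as small). Linear substitute (LS): a function $v$ of $\mathbf x\in\mathbb R_{\ge0}^n$ (or of $\mathbf x$ in a box $\prod_i[0,L_i]$) with demand set $\mathcal D(v,\mathbf q)=\arg\max_{\mathbf x}\{v(\mathbf x)-\mathbf q\cdot\mathbf x\}$ is LS if for all price vectors $\mathbf q,\mathbf q'\in\mathbb R_{\ge 0}^n$ with $q_j\le q'_j$ for one index $j$ and $q_k=q'_k$ for all $k\ne j$, and every $X\in\mathcal D(v,\mathbf q)$, there is $Y\in\mathcal D(v,\mathbf q')$ with $Y_k\ge X_k$ for all $k\neq j$. Fractional residual optimum: $f(\mathbf x)=\min\sum_j\frac{w_j}{p_j}\int_{\tilde t\ge0}\tilde t\, z_j(\tilde t)\,d\tilde t$ subject to $\int_{\tilde t\ge 0}z_j(\tilde t)\,d\tilde t=x_j$ for all alive jobs $j$, and $\mathbf z(\tilde t)\in\mathcal P$ for all $\tilde t\ge0$ (here $p_j$ is the original size; a minimizer is assumed to exist). Gradient descent (GD): at each time, process jobs so as to decrease $f(\mathbf p(t))$ at the maximum possible rate, where $\mathbf p(t)$ is the vector of remaining sizes. Concretely: whenever a job arrives, at time $t$ say, compute a minimizer $\mathbf z(\cdot)$ of $\sum_j\frac{w_j}{p_j}\int_{\tilde t\ge0}\tilde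 t\, z_j(\tilde t)\,d\tilde t$ subject to $\int_{\tilde t\ge 0}z_j(\tilde t)\,d\tilde t=p_j(t)$ for all alive jobs $j$ and $\mathbf z(\tilde t)\in\mathcal P$ for all $\tilde t\ge0$ (i.e. an optimal solution attaining $f(\mathbf p(t))$), and follow it until the next arrival; i.e. with speed $s$, process jobs at rates $s\,\mathbf z(s\tau)$ at time $t+\tau$. *)

(* Defs.v *)
From HB Require Import structures.
From mathcomp Require Import all_boot all_order all_algebra.
From mathcomp Require Import all_classical all_reals all_analysis.

Set Implicit Arguments.
Unset Strict Implicit.
Unset Printing Implicit Defensive.

Import Order.TTheory GRing.Theory Num.Theory.
Import numFieldNormedType.Exports.

Local Open Scope classical_set_scope.
Local Open Scope ring_scope.

(* Vectors indexed by the job set J = 'I_n are row vectors z : 'rV[R]_n, and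
   z 0 j is the coordinate of job j. *)

Section vectors.
Context {R : realType} {n : nat}.
Implicit Types (x y q : 'rV[R]_n) (v : 'rV[R]_n -> R).

Definition vle x y : Prop := forall j, x 0 j <= y 0 j.

Definition dot q x : R := \sum_j q 0 j * x 0 j.

Definition demand v q : set 'rV[R]_n :=
  [set x | vle 0 x /\
     forall y, vle 0 y -> v y - dot q y <= v x - dot q x].

Definition linear_substitute v : Prop :=
  forall (q q' : 'rV[R]_n) (j : 'I_n),
    vle 0 q -> vle 0 q' ->
    q 0 j <= q' 0 j -> (forall k, k != j -> q 0 k = q' 0 k) ->
    forall X, demand v q X ->
      exists2 Y, demand v q' Y & forall k, k != j -> X 0 k <= Y 0 k.

End vectors.

Section polytope.
Context {R : realType} {n : nat}.
Implicit Types (P : set 'rV[R]_n).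

Record scheduling_polytope P : Prop := SchedulingPolytope {
  polytope_nonempty : P !=set0 ;
  polytope_convex : convex_set P ;
  polytope_compact : compact P ;
  polytope_ge0 : forall z, P z -> vle 0 z ;
  polytope_down : forall z z', vle 0 z' -> vle z' z -> P z -> P z' ;
  polytope_pos : forall j, exists2 z, P z & 0 < z 0 j }.

(* For compact downward-closed P and x >= 0 the supremum is a maximum. *)
Definition rate_value P (c x : 'rV[R]_n) : R :=
  sup [set dot c z | z in [set z | [/\ P z, vle 0 z & vle z x]]].

End polytope.

Section residual.
Context {R : realType} {n : nat}.
Local Notation mu := (@lebesgue_measure R).

(* d 0 j stands for w_j / p_j, and x is the vector of remaining sizes.
   The alive jobs are those with x 0 j != 0; the program has no rate variable
   for the others, which is encoded by a rate that is identically 0. *)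
Definition residual_feasible (P : set 'rV[R]_n) (x : 'rV[R]_n)
    (z : R -> 'rV[R]_n) : Prop :=
  [/\ forall j, measurable_fun (`[0, +oo[ : set R) (fun t : R => z t 0 j),
      forall t, 0 <= t -> P (z t),
      forall j, x 0 j = 0 -> forall t, 0 <= t -> z t 0 j = 0 &
      forall j, (\int[mu]_(t in `[0%R, +oo[) (z t 0 j)%:E = (x 0 j)%:E)%E].

Definition residual_cost (d : 'rV[R]_n) (z : R -> 'rV[R]_n) : \bar R :=
  (\sum_j (d 0 j)%:E * \int[mu]_(t in `[0%R, +oo[) (t * z t 0%R j)%:E)%E.

Definition residual_optimum (P : set 'rV[R]_n) (d x : 'rV[R]_n) : \bar R :=
  ereal_inf [set residual_cost d z | z in residual_feasible P x].

Definition residual_minimizer (P : set 'rV[R]_n) (d x : 'rV[R]_n)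
    (z : R -> 'rV[R]_n) : Prop :=
  residual_feasible P x z /\ residual_cost d z = residual_optimum P d x.

Definition residual_attained (P : set 'rV[R]_n) : Prop :=
  forall d x : 'rV[R]_n, vle 0 d -> vle 0 x ->
    exists z, residual_minimizer P d x z.

End residual.

(* A finite job sequence over the potential jobs 'I_n: only the jobs in [jobs]
   ever arrive. The data of the other jobs are irrelevant. *)
Record instance (R : realType) (n : nat) := Instance {
  jobs : {set 'I_n} ;
  release : 'I_n -> R ;
  job_size : 'I_n -> R ;
  weight : 'I_n -> R ;
  job_size_gt0 : forall j, j \in jobs -> 0 < job_size j ;
  weight_ge0 : forall j, j \in jobs -> 0 <= weight j }.

Section schedules.
Context {R : realType} {n : nat}.
Local Notation mu := (@lebesgue_measure R).
Implicit Types (P : set 'rV[R]_n) (I : instance R n) (s c t : R) (j : 'I_n).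

Definition schedule := R -> 'rV[R]_n.
Definition algorithm := instance R n -> schedule.

Definition arrived I t j : bool := (j \in jobs I) && (release I j <= t).

Definition feasible P s I (Z : schedule) : Prop :=
  [/\ forall j, measurable_fun [set: R] (fun t : R => Z t 0 j),
      forall t, exists2 z, P z & Z t = s *: z,
      forall t j, ~~ arrived I t j -> Z t 0 j = 0 &
      forall j, j \in jobs I ->
        (\int[mu]_(t in `[release I j, +oo[) (Z t 0 j)%:E
           = (job_size I j)%:E)%E].

Definition fractional_flow I (Z : schedule) : \bar R :=
  (\sum_(j in jobs I)
     \int[mu]_(t in `[release I j, +oo[)
       (weight I j / job_size I j * (t - release I j) * Z t 0%R j)%:E)%E.

(* The infimum is a minimum whenever the set is nonempty; it is +oo for a job
   that is never finished in finite time. *)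
Definition completion_time I (Z : schedule) j : \bar R :=
  ereal_inf [set (t'%:E)%E | t' in [set t' : R | release I j <= t' /\
    (\int[mu]_(t in `[release I j, t']) (Z t 0 j)%:E
       = (job_size I j)%:E)%E]].

Definition integral_flow I (Z : schedule) : \bar R :=
  (\sum_(j in jobs I)
     (weight I j)%:E * (completion_time I Z j - (release I j)%:E))%E.

Definition offline_optimum (obj : instance R n -> schedule -> \bar R) P I :
    \bar R :=
  ereal_inf [set obj I Z | Z in feasible P 1 I].

Definition competitive (obj : instance R n -> schedule -> \bar R) P s c
    (A : algorithm) : Prop :=
  forall I, feasible P s I (A I) /\
    (obj I (A I) <= c%:E * offline_optimum obj P I)%E.

Definition agree_upto t I I' : Prop :=
  forall j, arrived I t j = arrived I' t j /\
    (arrived I t j -> [/\ release I j = release I' j,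
                          job_size I j = job_size I' j &
                          weight I j = weight I' j]).

Definition online (A : algorithm) : Prop :=
  forall t I I', agree_upto t I I' -> A I t = A I' t.

Definition remaining I (Z : schedule) t : 'rV[R]_n :=
  \row_j (if arrived I t j
          then job_size I j - \int[mu]_(u in `[release I j, t]) Z u 0 j
          else 0).

Definition density I : 'rV[R]_n :=
  \row_j (if j \in jobs I then weight I j / job_size I j else 0).

(* Minimizers need not be unique, so this is a relation: any minimizer may be
   chosen at each arrival. *)
Definition gradient_descent P s I (Z : schedule) : Prop :=
  (forall t, (forall j, ~~ arrived I t j) -> Z t = 0) /\
  forall i, i \in jobs I ->
    exists2 z, residual_minimizer P (density I)
                 (remaining I Z (release I i)) z &
      forall tau, 0 <= tau ->
        (forall j, arrived I (release I i + tau) j ->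
                   arrived I (release I i) j) ->
        Z (release I i + tau) = s *: z (s * tau).

Definition gd_algorithm P s (A : algorithm) : Prop :=
  forall I, gradient_descent P s I (A I).

End schedules.

Arguments schedule : clear implicits.
Arguments algorithm : clear implicits.

(* Main.v *)
(* As [rate_value P c] is linear substitute for every [c >= 0], the support
   function of [P] is submodular: the indirect utility at prices [q] is the
   support function at [c - q], its subgradients are minus the demands, and
   substitutes make them monotone. By Lagrangian duality the residual optimum [f]
   is [f x = max_l (l . x - int_t h (l - t d))] with [h] the support function and
   [d] the densities, so submodularity of [h] makes [f] supermodular; [f] is
   convex as well.

   Let [xA] and [xO] be the remaining sizes under GD, run with speed [1 + eps],
   and under an offline schedule. Following a minimizer, GD decreases [f xA] at
   rate [(1 + eps) W_A], where [W_A] is the fractional weight alive, whereas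
   [f (xA + xO)] decreases at rate at most [(2 + eps) (W_A + W_O)], as two
   schedules superpose to one of speed [2 + eps]. Hence the potential
   [(2 / eps) (f xA - f (xA + xO) / 2)] plus the flow of GD grows at rate at most
   [(1 + 2 / eps) W_O], and an arrival does not increase it, by convexity and
   supermodularity. All of this is done in integrated form between consecutive
   arrivals.

   For the integral objective, each job is processed [1 + a] times as fast as by
   GD with speed [1 + a], until it is complete: at that time GD still has the
   fraction [a / (1 + a)] of the job left, and this has waited all along. *)
Require Import Defs.
From HB Require Import structures.
From mathcomp Require Import all_boot all_order all_algebra.
From mathcomp Require Import all_classical all_reals all_analysis.
From mathcomp Require Import measurable_realfun ring lra.
Import Order.TTheory GRing.Theory Num.Theory.
Import numFieldNormedType.Exports.
Local Open Scope classical_set_scope.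
Local Open Scope ring_scope.
Set Implicit Arguments.
Unset Strict Implicit.
Unset Printing Implicit Defensive.

(** Nothing is differentiated along the schedules. Each estimate on [f] comes from exhibiting a
    plan: what remains of a minimizer bounds [f] after a window, and two superposed schedules
    followed by an optimal continuation bound [f (xA + xO)] before it. Windows are then summed by
    induction over release times. Supermodularity is obtained without strong duality. As [f] is
    finite, convex and monotone on the orthant, it has subgradients there, and these serve as
    optimal multipliers. The price is two small errors: the horizon is cut at a finite time, and
    maximizing rates are replaced by step functions, which are measurable for free. The sum
    [xA + xO] lives over the same jobs as [xA], so an arriving job enters it twice. This is why the
    potential halves [f (xA + xO)], and why convexity is needed next to supermodularity: it compares
    the first copy of a job with the average of both. *)

(** * Row vectors with the coordinatewise order, inner products, maxima and minima *)

Section vectors.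
Context {R : realType} {n : nat}.
Implicit Types (x y u w : 'rV[R]_n).

Lemma vle_refl x : vle x x. Proof. by move=> j. Qed.

Lemma vle_trans y x u : vle x y -> vle y u -> vle x u.
Proof. by move=> xy yu j; exact: le_trans (xy j) (yu j). Qed.

Lemma vle0P x : vle 0 x <-> forall j, 0 <= x 0 j.
Proof. by split=> h j; move: (h j); rewrite mxE. Qed.

Lemma vle_ge0 x j : vle 0 x -> 0 <= x 0 j.
Proof. by move/vle0P. Qed.

Lemma vleD0 x y : vle 0 x -> vle 0 y -> vle 0 (x + y).
Proof. by move=> /vle0P x0 /vle0P y0; apply/vle0P => j; rewrite mxE addr_ge0. Qed.

Lemma rowD x y j : (x + y) 0 j = x 0 j + y 0 j.
Proof. by rewrite mxE. Qed.

Lemma rowB x y j : (x - y) 0 j = x 0 j - y 0 j.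
Proof. by rewrite !mxE. Qed.

Lemma dotDl u w x : dot (u + w) x = dot u x + dot w x.
Proof. by rewrite /dot -big_split; apply: eq_bigr => j _; rewrite mxE mulrDl. Qed.

Lemma dotDr u x y : dot u (x + y) = dot u x + dot u y.
Proof. by rewrite /dot -big_split; apply: eq_bigr => j _; rewrite mxE mulrDr. Qed.

Lemma dotNl u x : dot (- u) x = - dot u x.
Proof. by rewrite /dot -sumrN; apply: eq_bigr => j _; rewrite mxE mulNr. Qed.

Lemma dotNr u x : dot u (- x) = - dot u x.
Proof. by rewrite /dot -sumrN; apply: eq_bigr => j _; rewrite mxE mulrN. Qed.

Lemma dotZl k u x : dot (k *: u) x = k * dot u x.
Proof. by rewrite /dot mulr_sumr; apply: eq_bigr => j _; rewrite mxE mulrA. Qed.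

Lemma dotZr k u x : dot u (k *: x) = k * dot u x.
Proof. by rewrite /dot mulr_sumr; apply: eq_bigr => j _; rewrite mxE mulrCA. Qed.

Lemma dotBl u w x : dot (u - w) x = dot u x - dot w x.
Proof. by rewrite dotDl dotNl. Qed.

Lemma dotBr u x y : dot u (x - y) = dot u x - dot u y.
Proof. by rewrite dotDr dotNr. Qed.

Lemma dot0r u : dot u 0 = 0.
Proof. by rewrite /dot big1// => j _; rewrite mxE mulr0. Qed.

Lemma dot_ge0 u x : vle 0 u -> vle 0 x -> 0 <= dot u x.
Proof.
by move=> /vle0P u0 /vle0P x0; apply: sumr_ge0 => j _; rewrite mulr_ge0.
Qed.

Lemma ler_dotr u x y : vle 0 u -> vle x y -> dot u x <= dot u y.
Proof. by move=> /vle0P u0 xy; apply: ler_sum => j _; rewrite ler_wpM2l. Qed.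

Lemma ler_dotl u w x : vle 0 x -> vle u w -> dot u x <= dot w x.
Proof. by move=> /vle0P x0 uw; apply: ler_sum => j _; rewrite ler_wpM2r. Qed.

Lemma dot_continuous u : continuous (dot u).
Proof.
apply: (@continuous_big R^o 'I_n +%R 0 xpredT (@add_continuous R^o)).
move=> j _ x; apply: (@continuousM _ _ (fun=> u 0 j) (fun x => x 0 j)).
  exact: cst_continuous.
exact: coord_continuous.
Qed.

Definition vmax x y : 'rV[R]_n := \row_j Num.max (x 0 j) (y 0 j).
Definition vmin x y : 'rV[R]_n := \row_j Num.min (x 0 j) (y 0 j).

Lemma vmax_add_min x y : vmax x y + vmin x y = x + y.
Proof. by apply/rowP => j; rewrite !mxE addr_max_min. Qed.

(** Rearrangement inequality: coordinatewise, pairing larger with larger and smaller with smaller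
    maximizes the sum of the two products. *)
Lemma dot_max_min u w x y :
  dot u x + dot w y <= dot (vmax u w) (vmax x y) + dot (vmin u w) (vmin x y).
Proof.
rewrite /dot -!big_split; apply: ler_sum => j _; rewrite !mxE /=.
move: (u 0 j) (w 0 j) (x 0 j) (y 0 j) => a b c d.
by case: (leP a b) => ab; case: (leP c d) => cd; nra.
Qed.

End vectors.

(** * The support function of the polytope *)

Section support_function.
Context {R : realType} {n : nat} (P : set 'rV[R]_n).
Hypothesis polP : scheduling_polytope P.
Implicit Types (z u w q c X : 'rV[R]_n).

Definition support_fun u : R := sup [set dot u z | z in P].

Lemma support_funP u : exists2 z, P z & dot u z = support_fun u.
Proof.
have [z + zmax] := EVT_max_rV (polytope_nonempty polP) (polytope_compact polP)
  (continuous_subspaceT (dot_continuous (u := u))).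
rewrite inE => Pz; exists z => //; apply/eqP; rewrite eq_le; apply/andP; split.
  apply: ub_le_sup; last by exists z.
  by exists (dot u z) => _ [z' Pz' <-]; apply: zmax; rewrite inE.
apply: ge_sup; first by exists (dot u z), z.
by move=> _ [z' Pz' <-]; apply: zmax; rewrite inE.
Qed.

Lemma support_ub u z : P z -> dot u z <= support_fun u.
Proof.
move=> Pz; have [z0 _ _] := support_funP u.
apply: ub_le_sup; last by exists z.
have [z1 + zmax] := EVT_max_rV (polytope_nonempty polP) (polytope_compact polP)
  (continuous_subspaceT (dot_continuous (u := u))).
by move=> _; exists (dot u z1) => _ [z' Pz' <-]; apply: zmax; rewrite inE.
Qed.

Lemma polytope0 : P 0.
Proof.
have [z Pz] := polytope_nonempty polP.
apply: (polytope_down polP _ _ Pz); first exact: vle_refl.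
exact: (polytope_ge0 polP).
Qed.

Lemma support_ge0 u : 0 <= support_fun u.
Proof. by rewrite -(dot0r u); exact: support_ub polytope0. Qed.

Lemma le_support u w : vle u w -> support_fun u <= support_fun w.
Proof.
move=> uw; have [z Pz <-] := support_funP u.
apply: le_trans (support_ub _ Pz); apply: ler_dotl => //.
exact: (polytope_ge0 polP).
Qed.

Lemma supportD u w : support_fun (u + w) <= support_fun u + support_fun w.
Proof.
have [z Pz <-] := support_funP (u + w).
by rewrite dotDl lerD// support_ub.
Qed.

Lemma supportZ k u : 0 <= k -> support_fun (k *: u) <= k * support_fun u.
Proof.
move=> k0; have [z Pz <-] := support_funP (k *: u).
by rewrite dotZl ler_wpM2l// support_ub.
Qed.

Lemma polytope_bounded z j : P z -> z 0 j <= support_fun (const_mx 1).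
Proof.
move=> Pz; apply: le_trans (support_ub _ Pz).
rewrite /dot (bigD1 j)//= mxE mul1r lerDl sumr_ge0// => k _.
by rewrite mxE mul1r; move: k; apply/vle0P; exact: (polytope_ge0 polP).
Qed.

Section substitutes.
Hypothesis lsP : forall c, vle 0 c -> linear_substitute (rate_value P c).

Lemma le_rate_value c X z : P z -> vle z X -> dot c z <= rate_value P c X.
Proof.
move=> Pz zX; apply: ub_le_sup; last first.
  by exists z => //; split=> //; exact: (polytope_ge0 polP).
by exists (support_fun c) => _ [z' [Pz' _ _] <-]; exact: support_ub.
Qed.

(** Prices are nonnegative, so buying more than the rates [z] actually used does not raise the
    utility, and [z] alone earns [dot (c - q) z]. *)
Lemma rate_value_le c q X : vle 0 q -> vle 0 X ->
  rate_value P c X - dot q X <= support_fun (c - q).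
Proof.
move=> q0 X0; rewrite lerBlDr; apply: ge_sup.
  exists (dot c 0), 0 => //.
  by split; [exact: polytope0|exact: vle_refl|exact: X0].
move=> _ [z [Pz z0 zX] <-].
have := support_ub (c - q) Pz; have := ler_dotr q0 zX; rewrite dotBl; lra.
Qed.

Lemma demand_support c q z : vle 0 q -> P z -> dot (c - q) z = support_fun (c - q) ->
  demand (rate_value P c) q z.
Proof.
move=> q0 Pz zE; split; first exact: (polytope_ge0 polP).
move=> y y0; have := rate_value_le c q0 y0.
have := le_rate_value c Pz (vle_refl z); move: zE; rewrite dotBl; lra.
Qed.

(** A demand need not lie in [P], but it is at least as good as a point of [P] that maximizes
    [c - q]. *)
Lemma demand_value c q X : vle 0 q -> demand (rate_value P c) q X ->
  rate_value P c X - dot q X = support_fun (c - q).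
Proof.
move=> q0 [X0 Xmax]; apply/eqP; rewrite eq_le rate_value_le//=.
have [z Pz zE] := support_funP (c - q).
have := Xmax z (polytope_ge0 polP Pz); have := le_rate_value c Pz (vle_refl z).
by move: zE; rewrite dotBl; lra.
Qed.

(** The substitutes property raises one price; here the prices are raised one coordinate after the
    other, and the demands found on the way are chained. *)
Lemma linear_substitute_vle c q q' X : vle 0 c -> vle 0 q -> vle q q' ->
    demand (rate_value P c) q X ->
  exists2 Y, demand (rate_value P c) q' Y &
    forall k, q 0 k = q' 0 k -> X 0 k <= Y 0 k.
Proof.
move=> c0 q0 qq' DX.
suff H : forall s : seq 'I_n, forall q', vle q q' ->
    (forall k, k \notin s -> q 0 k = q' 0 k) ->
    exists2 Y, demand (rate_value P c) q' Y &
      forall k, q 0 k = q' 0 k -> X 0 k <= Y 0 k.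
  by apply: (H (enum 'I_n)) => // k; rewrite mem_enum.
elim=> [|j s IH] {qq'}q' qq' qs.
  by exists X => //; suff -> : q' = q by []; apply/rowP => k; rewrite qs.
pose q2 : 'rV[R]_n := \row_k (if k == j then q 0 j else q' 0 k).
have qq2 : vle q q2 by move=> k; rewrite mxE; case: eqP => [->|].
have [|Y DY XY] := IH q2 qq2.
  move=> k ks; rewrite mxE; case: (eqVneq k j) => [->//|kj].
  by apply: qs; rewrite in_cons negb_or kj.
(* A price that does not change must be skipped: applying the substitutes property at [j] would lose
   the comparison at coordinate [j]. *)
have [qj|qj] := eqVneq (q 0 j) (q' 0 j).
  have q2E : q2 = q' by apply/rowP => k; rewrite mxE; case: eqP => [->|].
  by exists Y; rewrite -q2E.
have [| | | |Y' DY' YY'] := @lsP c c0 q2 q' j _ _ _ _ Y DY.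
- exact: vle_trans q0 qq2.
- exact: vle_trans q0 qq'.
- by rewrite mxE eqxx.
- by move=> k kj; rewrite mxE (negbTE kj).
exists Y' => // k qk; have kj : k != j.
  by apply: contra_neq qj => <-.
by apply: le_trans (YY' _ kj); apply: XY; rewrite mxE (negbTE kj).
Qed.

(* Minus a demand at [q] is a subgradient of [q |-> support_fun (c - q)]. The
   increments along [e] are compared over steps of length [1 / N], shifted by one
   step, which costs an error of order [1 / N] and avoids derivatives. *)
Lemma support_decreasing_differences c q a e :
    vle 0 c -> vle 0 q -> vle 0 a -> vle 0 e ->
    (forall k, a 0 k = 0 \/ e 0 k = 0) ->
  support_fun (c - (q + a + e)) - support_fun (c - (q + a)) <=
  support_fun (c - (q + e)) - support_fun (c - q).
Proof.
move=> c0 q0 a0 e0 ae.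
apply/ler_addgt0Pr => eps eps0.
pose N := (Num.truncn (support_fun e / eps)).+1.
pose r : R := N%:R^-1.
have N0 : (0 : R) < N%:R by rewrite ltr0n.
have r0 : 0 < r by rewrite invr_gt0.
have reps : r * support_fun e <= eps.
  by rewrite mulrC ler_pdivrMr// mulrC -ler_pdivrMr// ltW// truncnS_gt.
have re0 i : vle 0 ((r * i%:R) *: e).
  by apply/vle0P => j; rewrite mxE mulr_ge0 ?vle_ge0// mulr_ge0// ltW.
pose phi0 i := support_fun (c - (q + (r * i%:R) *: e)).
pose phi1 i := support_fun (c - (q + a + (r * i%:R) *: e)).
(* With [X] and [Y] demanded at the two prices reached after [i.+1] steps, the left side is at most
   [- r * dot e Y] and the right side at least [- r * dot e X]. Where [e] is positive, [a] vanishes,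
   and there [X] is below [Y]. *)
have step i : phi1 i.+1 - phi1 i <= phi0 i.+2 - phi0 i.+1.
  pose q0' := q + (r * i.+1%:R) *: e; pose q1 := q + a + (r * i.+1%:R) *: e.
  have q0'0 : vle 0 q0' by apply: vleD0.
  have q10 : vle 0 q1 by apply: vleD0 => //; apply: vleD0.
  have [X PX XE] := support_funP (c - q0').
  have DX := demand_support q0'0 PX XE.
  have [|Y DY XY] := linear_substitute_vle (q' := q1) c0 q0'0 _ DX.
    by move=> k; rewrite !mxE lerD2r lerDl; exact: vle_ge0.
  have eXY : dot e X <= dot e Y.
    apply: ler_sum => k _; have [ak|->] := ae k; last by rewrite !mul0r.
    rewrite ler_wpM2l//; first exact: vle_ge0.
    by apply: XY; rewrite !mxE ak addr0.
  have YE := demand_value q10 DY.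
  have := rate_value_le c (vleD0 q0'0 (re0 1%N)) (polytope_ge0 polP PX).
  have -> : q0' + (r * 1) *: e = q + (r * i.+2%:R) *: e.
    by rewrite /q0' -addrA -scalerDl -mulrDr natr1.
  have := rate_value_le c (vleD0 (vleD0 q0 a0) (re0 i)) DY.1.
  have XE' := demand_value q0'0 DX.
  rewrite -/(phi1 i) -/(phi0 i.+2).
  have -> : phi0 i.+1 = support_fun (c - q0') by [].
  have -> : phi1 i.+1 = support_fun (c - q1) by [].
  rewrite -XE' -YE /q0' /q1 !dotDl !dotZl -!natr1.
  by move: (dot e X) (dot e Y) eXY => eX eY; nra.
have tele i : phi1 i - phi1 0%N <= phi0 i.+1 - phi0 1%N.
  elim: i => [|i IH]; first by rewrite !subrr.
  by have := step i; lra.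
have rN : r * N%:R = 1 by rewrite mulVf// gt_eqF.
have phi0N : phi0 N = support_fun (c - (q + e)) by rewrite /phi0 rN scale1r.
have phi1N : phi1 N = support_fun (c - (q + a + e)) by rewrite /phi1 rN scale1r.
have phi00 : phi0 0%N = support_fun (c - q) by rewrite /phi0 mulr0 scale0r addr0.
have phi10 : phi1 0%N = support_fun (c - (q + a)) by rewrite /phi1 mulr0 scale0r addr0.
have := tele N; rewrite phi1N phi10.
have : phi0 N.+1 <= phi0 N.
  apply: le_support => j; rewrite !mxE lerD2l lerN2 lerD2l ler_wpM2r ?ler_wpM2l//.
  - exact: vle_ge0.
  - exact: ltW.
  - by rewrite ler_nat.
have : phi0 0%N <= phi0 1%N + eps.
  apply: le_trans (lerD (lexx _) reps).
  apply: le_trans (lerD (lexx _) (supportZ _ (ltW r0))).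
  apply: le_trans (supportD _ _).
  by rewrite /phi0 mulr0 scale0r addr0 mulr1 opprD addrA subrK.
by rewrite phi0N phi00; lra.
Qed.

(** The increments [vmax u w - u] and [vmax u w - w] have disjoint supports, since each coordinate
    of the maximum is attained by [u] or by [w]. Raising prices by one, by the other or by both
    leads from the maximum to [u], to [w] and to the minimum. *)
Lemma support_submodular u w :
  support_fun (vmax u w) + support_fun (vmin u w) <= support_fun u + support_fun w.
Proof.
(* A nonnegative vector above the maximum, so that the initial prices [c - vmax u w] are
   nonnegative. *)
pose c : 'rV[R]_n := \row_j `|vmax u w 0 j|.
have := @support_decreasing_differences c (c - vmax u w) (vmax u w - u)
  (vmax u w - w).
have <- : u = c - (c - vmax u w + (vmax u w - u)).
  by apply/rowP => j; rewrite !mxE; lra.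
have <- : w = c - (c - vmax u w + (vmax u w - w)).
  by apply/rowP => j; rewrite !mxE; lra.
have <- : vmin u w = c - (c - vmax u w + (vmax u w - u) + (vmax u w - w)).
  apply/rowP => j; have /rowP/(_ j) := vmax_add_min u w.
  by rewrite !mxE; lra.
have <- : vmax u w = c - (c - vmax u w) by rewrite subKr.
move=> submod; suff : support_fun (vmin u w) - support_fun u <=
  support_fun w - support_fun (vmax u w) by lra.
apply: submod.
- by apply/vle0P => j; rewrite mxE.
- by apply/vle0P => j; have := ler_norm (vmax u w 0 j); rewrite !mxE; lra.
- by apply/vle0P => j; rewrite !mxE subr_ge0 le_max lexx.
- by apply/vle0P => j; rewrite !mxE subr_ge0 le_max lexx orbT.
- by move=> j; rewrite !mxE; case: leP => _; [right|left]; rewrite subrr.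
Qed.

End substitutes.
End support_function.

(** * Subgradients of convex functions *)

Section subgradient.
Context {R : realType} {n : nat}.
Implicit Types (x y a v l : 'rV[R]_n).

(* One-dimensional Hahn-Banach step, one coordinate at a time. *)
Lemma convex_subgradient (g : 'rV[R]_n -> R) a :
    (forall x y (t : R), 0 <= t -> t <= 1 ->
      g (t *: x + (1 - t) *: y) <= t * g x + (1 - t) * g y) ->
  exists l, forall y, g a + dot l (y - a) <= g y.
Proof.
move=> gconv.
suff [l H] : exists l, forall v, (forall k, k \notin enum 'I_n -> v 0 k = 0) ->
    g a + dot l v <= g (a + v).
  exists l => y; rewrite -[y in leRHS](subrKC a); apply: H => k.
  by rewrite mem_enum.
elim: (enum 'I_n) => [|j s [l IH]].
  exists 0 => v v0; have -> : v = 0 by apply/rowP => k; rewrite v0// mxE.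
  by rewrite dot0r !addr0.
have [js|js] := boolP (j \in s).
  exists l => w ws; apply: IH => k ks; apply: ws.
  by rewrite in_cons negb_or ks andbT; apply: contraNneq ks => ->.
pose e : 'rV[R]_n := delta_mx 0 j.
pose off v := forall k, k \notin s -> v 0 k = 0.
(* The slopes that [l] leaves in the direction of [- e]. [Lub] shows that each is at most every
   slope in the direction of [e], so their supremum is a valid coordinate of the subgradient at
   [j]. *)
pose L := [set r | exists v t, [/\ off v, 0 < t &
  r = (g a + dot l v - g (a + v - t *: e)) / t]].
have Lub v' t' : off v' -> 0 < t' ->
    ubound L ((g (a + v' + t' *: e) - g a - dot l v') / t').
  move=> v's t'0 _ [v [t [vs t0 ->]]].
  have tt0 : 0 < t + t' by rewrite addr_gt0.
  rewrite ler_pdivrMr// mulrAC ler_pdivlMr//.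
  (* The weights for which the components [- t *: e] and [t' *: e] cancel, leaving a point covered
     by the induction hypothesis. *)
  pose p := t' / (t + t').
  have p0 : 0 <= p by rewrite divr_ge0// ltW.
  have p1 : p <= 1 by rewrite ler_pdivrMr// mul1r lerDr ltW.
  have pE : 1 - p = t / (t + t') by rewrite /p; field; rewrite gt_eqF.
  have := gconv (a + v - t *: e) (a + v' + t' *: e) p p0 p1.
  have -> : p *: (a + v - t *: e) + (1 - p) *: (a + v' + t' *: e) =
      a + (p *: v + (1 - p) *: v').
    apply/rowP => k; rewrite !mxE pE /p; field; rewrite gt_eqF//.
  have H : off (p *: v + (1 - p) *: v').
    by move=> k ks; rewrite !mxE vs// v's// !mulr0 addr0.
  move=> /(le_trans (IH _ H)).
  rewrite dotDr !dotZr pE /p.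
  move: (g _) (g (a + v' + _)) (g a) (dot l v) (dot l v') => A B C D E.
  rewrite -(ler_pM2r tt0).
  have -> : (C + (t' / (t + t') * D + t / (t + t') * E)) * (t + t') =
    C * (t + t') + t' * D + t * E by field; rewrite gt_eqF.
  have -> : (t' / (t + t') * A + t / (t + t') * B) * (t + t') =
    t' * A + t * B by field; rewrite gt_eqF.
  by lra.
have L0 : L !=set0.
  exists ((g a + dot l 0 - g (a + 0 - 1 *: e)) / 1); exists 0, 1; split=> //.
  by move=> k; rewrite mxE.
pose m := sup L.
exists (\row_k (if k == j then m else l 0 k)) => w ws.
pose t := w 0 j.
pose v := w - t *: e.
have vs : off v.
  move=> k ks; rewrite !mxE eqxx/=; have [->|kj] := eqVneq k j.
    by rewrite mulr1 subrr.
  by rewrite mulr0 subr0 ws// in_cons negb_or kj.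
have -> : dot (\row_k (if k == j then m else l 0 k)) w = dot l v + m * t.
  rewrite /dot (bigD1 j)//= mxE eqxx addrC [in RHS](bigD1 j)//= vs// mulr0 add0r.
  congr (_ + _); apply: eq_bigr => k kj; rewrite !mxE (negbTE kj) eqxx/=.
  by rewrite mulr0 subr0.
have wE : a + w = a + v + t *: e by rewrite /v -addrA subrK.
have [t0|t0|t0] := ltgtP t 0.
- have : (g a + dot l v - g (a + v - (- t) *: e)) / (- t) <= m.
    apply: ub_le_sup; first by exists ((g (a + 0 + 1 *: e) - g a - dot l 0) / 1);
      apply: Lub => // k; rewrite mxE.
    by exists v, (- t); split; rewrite ?oppr_gt0.
  rewrite ler_pdivrMr ?oppr_gt0// scaleNr opprK -wE; nra.
- have : m <= (g (a + v + t *: e) - g a - dot l v) / t.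
    by apply: ge_sup => //; apply: Lub.
  by rewrite ler_pdivlMr// -wE; nra.
- by rewrite wE t0 mulr0 addr0 scale0r addr0; exact: IH.
Qed.

(* The function is extended to all of [R^n] through the positive part. *)
Lemma convex_subgradient_orthant (f : 'rV[R]_n -> R) a : vle 0 a ->
    (forall x y (t : R), vle 0 x -> vle 0 y -> 0 <= t -> t <= 1 ->
      f (t *: x + (1 - t) *: y) <= t * f x + (1 - t) * f y) ->
    (forall x y, vle 0 x -> vle x y -> f x <= f y) ->
  exists l, forall y, vle 0 y -> f a + dot l (y - a) <= f y.
Proof.
move=> a0 fconv fmono.
have pos0 x : vle 0 (vmax 0 x).
  by apply/vle0P => j; rewrite !mxE le_max lexx.
have pos_id x : vle 0 x -> vmax 0 x = x.
  by move=> x0; apply/rowP => j; rewrite !mxE max_r// vle_ge0.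
have [|l H] := @convex_subgradient (fun x => f (vmax 0 x)) a.
  (* The positive part is convex in each coordinate, and monotonicity of [f] carries this through
     the composition. *)
  move=> x y t t0 t1; apply: le_trans (fconv _ _ _ (pos0 x) (pos0 y) t0 t1).
  apply: fmono => // j; rewrite !mxE ge_max; apply/andP; split.
    by rewrite addr_ge0// mulr_ge0// ?subr_ge0// le_max lexx.
  by rewrite lerD// ler_wpM2l// ?subr_ge0// le_max lexx orbT.
by exists l => y y0; have := H y; rewrite !pos_id.
Qed.

End subgradient.

(** * Real-valued integrals and affine changes of variable *)

Section affine_substitution.
Context {R : realType}.
Notation mu := (@lebesgue_measure R).

(** Lebesgue measure is [s] times its own pushforward under [t |-> s * (t - c)]: both agree on the
    intervals []a, b]], which determine it. *)
Lemma ge0_integral_affine (s c : R) (g : R -> R) : 0 < s ->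
    measurable_fun (`[0, +oo[ : set R) g -> (forall t, 0 <= t -> 0 <= g t) ->
  (\int[mu]_(t in `[c, +oo[) (g (s * (t - c)))%:E =
   s^-1%:E * \int[mu]_(t in `[0%R, +oo[) (g t)%:E)%E.
Proof.
move=> s0 mg g0.
pose phi (t : measurableTypeR R) : measurableTypeR R := s * (t - c).
have mphi : measurable_fun setT phi.
  by apply: measurable_funM => //; exact: measurable_funB.
pose push := pushforward mu phi : {measure set (measurableTypeR R) -> \bar R}.
pose k : {nonneg R} := NngNum (ltW s0).
pose nu : {measure set (measurableTypeR R) -> \bar R} := mscale k (push mphi).
have muE A : measurable A -> mu A = nu A.
  apply: lebesgue_measure_unique => _ /ocitvP[->|[[a b] /= ab ->]].
    by rewrite !measure0.
  rewrite /nu /mscale /= /pushforward /=.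
  have -> : phi @^-1` `]a, b] = `](a / s + c), (b / s + c)]%classic.
    apply/seteqP; split=> t; rewrite /= !in_itv/= /phi -ltrBrDr -lerBlDr;
      by rewrite ltr_pdivrMr// ler_pdivlMr// ![_ * s]mulrC.
  rewrite !lebesgue_measure_itv/= !lte_fin ltrD2r ltr_pM2r ?invr_gt0// ab.
  by rewrite -!EFinD -EFinM; congr EFin; field; rewrite gt_eqF.
have -> : (\int[mu]_(t in `[0%R, +oo[) (g t)%:E =
    s%:E * \int[mu]_(t in `[c, +oo[) (g (s * (t - c)))%:E)%E.
  rewrite (eq_measure_integral nu); last by move=> A mA _; exact: muE.
  rewrite ge0_integral_mscale//; last 2 first.
  - exact/measurable_EFinP.
  - by move=> t /=; rewrite in_itv/= andbT lee_fin; exact: g0.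
  rewrite ge0_integral_pushforward//; last 2 first.
  - exact/measurable_EFinP.
  - by move=> t; rewrite inE/= in_itv/= andbT lee_fin; exact: g0.
  congr (_ * _)%E; rewrite (_ : _ @^-1` _ = `[c, +oo[%classic)//.
  by apply/seteqP; split=> t; rewrite /= !in_itv/= !andbT /phi (pmulr_rge0 _ s0);
    rewrite (subr_ge0 (c : R) (t : R)).
by rewrite muleA -EFinM mulVf ?gt_eqF// mul1e.
Qed.

End affine_substitution.

Section has_integral.
Context {R : realType}.
Notation mu := (@lebesgue_measure R).
Implicit Types (D : set R) (g : R -> R) (c : R).

(** Integrability and the value are bundled as a relation to a real number, so that volumes and
    costs can be handled by real arithmetic instead of in the extended reals. *)
Definition has_integral D g c : Prop :=
  mu.-integrable D (EFin \o g) /\ \int[mu]_(t in D) g t = c.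

Lemma has_integral_measurable D g c : has_integral D g c -> measurable_fun D g.
Proof. by case=> /integrableP[/measurable_EFinP]. Qed.

Lemma has_integral_unique D g c c' :
  has_integral D g c -> has_integral D g c' -> c = c'.
Proof. by move=> [_ <-] [_ <-]. Qed.

Section measurable_domain.
Variable D : set R.
Hypothesis mD : measurable D.

Lemma has_integralE g c :
  has_integral D g c -> (\int[mu]_(t in D) (g t)%:E = c%:E)%E.
Proof. by move=> [ig <-]; rewrite fineK//; exact: integrable_fin_num. Qed.

Lemma ge0_has_integral g c : measurable_fun D g -> (forall t, D t -> 0 <= g t) ->
  (\int[mu]_(t in D) (g t)%:E = c%:E)%E -> has_integral D g c.
Proof.
move=> mg g0 gc; split; last by rewrite /Rintegral gc.
apply/integrableP; split; first exact/measurable_EFinP.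
under eq_integral.
  move=> t; rewrite inE => Dt; rewrite /= ger0_norm ?g0//; over.
by rewrite gc ltry.
Qed.

Lemma eq_has_integral f g c : (forall t, D t -> f t = g t) ->
  has_integral D f c -> has_integral D g c.
Proof.
move=> fg [fi <-]; split.
  by apply: eq_integrable fi => // t; rewrite inE => Dt; rewrite /= fg.
by apply: eq_Rintegral => t; rewrite inE => Dt; rewrite fg.
Qed.

Lemma has_integral0 : has_integral D (fun=> 0) 0.
Proof.
apply: ge0_has_integral => //; rewrite integral0_eq//.
Qed.

Lemma has_integralD f g a b : has_integral D f a -> has_integral D g b ->
  has_integral D (fun t => f t + g t) (a + b).
Proof.
move=> [fi <-] [gi <-]; split; last by rewrite RintegralD.
have -> : (EFin \o fun t => f t + g t) = ((EFin \o f) \+ (EFin \o g))%E by [].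
exact: integrableD.
Qed.

Lemma has_integralZ k g c : has_integral D g c ->
  has_integral D (fun t => k * g t) (k * c).
Proof.
move=> [gi <-]; split; last by rewrite RintegralZl.
have -> : (EFin \o fun t => k * g t) = (fun t => k%:E * (EFin \o g) t)%E by [].
exact: integrableZl.
Qed.

Lemma has_integralB f g a b : has_integral D f a -> has_integral D g b ->
  has_integral D (fun t => f t - g t) (a - b).
Proof.
move=> hf /(has_integralZ (-1)) hg; rewrite -mulN1r.
by apply: eq_has_integral (has_integralD hf hg) => t _; rewrite mulN1r.
Qed.

Lemma has_integral_sum (I : Type) (s : seq I) (g : I -> R -> R) (c : I -> R) :
    (forall i, has_integral D (g i) (c i)) ->
  has_integral D (fun t => \sum_(i <- s) g i t) (\sum_(i <- s) c i).
Proof.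
move=> gc; elim: s => [|i s IH].
  by rewrite big_nil; apply: eq_has_integral has_integral0 => t _; rewrite big_nil.
rewrite big_cons; apply: eq_has_integral (has_integralD (gc i) IH) => t _.
by rewrite big_cons.
Qed.

Lemma le_has_integral f g a b : has_integral D f a -> has_integral D g b ->
  (forall t, D t -> f t <= g t) -> a <= b.
Proof. by move=> [fi <-] [gi <-] fg; exact: le_Rintegral. Qed.

Lemma has_integral_ge0 g c : has_integral D g c -> (forall t, D t -> 0 <= g t) ->
  0 <= c.
Proof. exact: le_has_integral has_integral0. Qed.

Lemma dominated_has_integral (f : R -> R) g c :
    measurable_fun D f -> has_integral D g c ->
  (forall t, D t -> `|f t| <= g t) -> exists b, has_integral D f b.
Proof.
move=> mf [gi _] fg; exists (\int[mu]_(t in D) f t); split=> //.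
apply: le_integrable gi => //; first exact/measurable_EFinP.
move=> t Dt /=; rewrite lee_fin (le_trans (fg _ Dt))// ler_norm//.
Qed.

End measurable_domain.

Lemma bounded_has_integral D g (M : R) : measurable D -> (mu D < +oo)%E ->
    measurable_fun D g -> (forall t, D t -> `|g t| <= M) ->
  exists c, has_integral D g c.
Proof.
move=> mD Dfin mg gM; exists (\int[mu]_(t in D) g t); split=> //.
apply: measurable_bounded_integrable => //.
exists M; split; first exact: num_real.
by move=> M' MM' t Dt; exact: le_trans (gM _ Dt) (ltW MM').
Qed.

Lemma itv_adjacent_disj (x y z : itv_bound R) :
  [disjoint [set` Interval x y] & [set` Interval y z]].
Proof.
apply/disj_setPS => t [] /=; rewrite !itv_boundlr => /andP[_ ty] /andP[yt _].
by have := le_trans ty yt; rewrite bnd_simp ltxx.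
Qed.

Lemma has_integral_cat (x y z : itv_bound R) g a b : (x <= y)%O -> (y <= z)%O ->
    has_integral [set` Interval x y] g a -> has_integral [set` Interval y z] g b ->
  has_integral [set` Interval x z] g (a + b).
Proof.
move=> xy yz [xyi <-] [yzi <-].
have mg : measurable_fun [set` Interval x z] g.
  rewrite (itv_bndbnd_setU xy yz); apply/measurable_funU => //.
  by split; apply/measurable_EFinP; [case/integrableP: xyi|case/integrableP: yzi].
have ig : mu.-integrable [set` Interval x z] (EFin \o g).
  apply/integrableP; split; first exact/measurable_EFinP.
  rewrite (itv_bndbnd_setU xy yz) ge0_integral_setU//=; last 2 first.
  - rewrite -(itv_bndbnd_setU xy yz); apply: measurableT_comp => //.
    by apply: measurableT_comp => //; exact/measurable_EFinP.
  - exact: itv_adjacent_disj.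
  by rewrite lte_add_pinfty//; [case/integrableP: xyi|case/integrableP: yzi].
split=> //; rewrite (itv_bndbnd_setU xy yz) Rintegral_setU//.
- by rewrite -itv_bndbnd_setU.
- exact: itv_adjacent_disj.
Qed.

Lemma has_integral_split (x y z : itv_bound R) g c : (x <= y)%O -> (y <= z)%O ->
    has_integral [set` Interval x z] g c ->
  exists a b, [/\ has_integral [set` Interval x y] g a,
    has_integral [set` Interval y z] g b & c = a + b].
Proof.
move=> xy yz hg; have ig := hg.1.
have hxy : has_integral [set` Interval x y] g
    (\int[mu]_(t in [set` Interval x y]) g t).
  by split=> //; apply: integrableS ig => //; exact: subset_itvl.
have hyz : has_integral [set` Interval y z] g
    (\int[mu]_(t in [set` Interval y z]) g t).
  by split=> //; apply: integrableS ig => //; exact: subset_itvr.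
do 2 eexists; split; [exact: hxy|exact: hyz|].
exact: has_integral_unique hg (has_integral_cat xy yz hxy hyz).
Qed.

Lemma measurable_fun_affine_itv (k a b : R) g : 0 < k ->
    measurable_fun (`[a, +oo[ : set R) g ->
  measurable_fun (`[b, +oo[ : set R) (fun t => g (a + k * (t - b))).
Proof.
move=> k0 mg; apply: (measurable_comp _ _ mg) => //.
  move=> _ [t /= + <-]; rewrite !in_itv/= !andbT => bt.
  by rewrite lerDl mulr_ge0 ?subr_ge0// ltW.
apply: measurable_funTS; apply: measurable_funD => //.
by apply: measurable_funM => //; exact: measurable_funB.
Qed.

Lemma has_integral_affine (k a b : R) g c : 0 < k ->
    (forall t, a <= t -> 0 <= g t) ->
    has_integral `[a, +oo[%classic g c ->
  has_integral `[b, +oo[%classic (fun t => g (a + k * (t - b))) (k^-1 * c).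
Proof.
move=> k0 g0 hg; have mg := has_integral_measurable hg.
pose h (u : R) := g (a + u).
have mh : measurable_fun (`[0, +oo[ : set R) h.
  have -> : h = (fun t => g (a + 1 * (t - 0))).
    by apply/funext => t; rewrite mul1r subr0.
  exact: measurable_fun_affine_itv.
have h0 t : 0 <= t -> 0 <= h t by move=> t0; apply: g0; rewrite lerDl.
apply: ge0_has_integral => //.
- exact: measurable_fun_affine_itv.
- move=> t /=; rewrite in_itv/= andbT => ta; apply: g0.
  by rewrite lerDl mulr_ge0 ?subr_ge0// ltW.
- rewrite (ge0_integral_affine b k0 mh h0).
  have := ge0_integral_affine a ltr01 mh h0.
  have -> : (fun t => (h (1 * (t - a)))%:E) = (fun t => (g t)%:E).
    by apply/funext => t; rewrite mul1r /h subrKC.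
  by rewrite (has_integralE _ hg)// invr1 mul1e EFinM => ->.
Qed.

Lemma has_integral_cst (a b k : R) : a <= b ->
  has_integral `[a, b[%classic (fun=> k) (k * (b - a)).
Proof.
move=> ab; have mab : mu `[a, b[%classic = (b - a)%:E.
  rewrite lebesgue_measure_itv/= lte_fin; have [|ba] := ltP a b; first by [].
  by rewrite (le_anti (introT andP (conj ab ba))) subrr.
have fin : (mu `[a, b[%classic < +oo)%E by rewrite mab ltry.
have [c [ic _]] := bounded_has_integral (measurable_itv `[a, b[) fin
  (measurable_cst k) (fun _ _ => lexx `|k|).
by split=> //; rewrite Rintegral_cst//; congr (_ * _); exact: (congr1 fine mab).
Qed.

End has_integral.

(** * Schedules as plans with a start time, a speed and a delay cost *)

Section plans.
Context {R : realType} {n : nat} (P : set 'rV[R]_n).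
Hypothesis polP : scheduling_polytope P.
Notation mu := (@lebesgue_measure R).
Implicit Types (D : set R) (Y : R -> 'rV[R]_n) (x u z : 'rV[R]_n) (s c : R).

Lemma polytope_conv (p : R) z1 z2 : 0 <= p -> p <= 1 -> P z1 -> P z2 ->
  P (p *: z1 + (1 - p) *: z2).
Proof.
move=> p0 p1 Pz1 Pz2.
have p01 : (0 <= p <= 1) by rewrite p0 p1.
have := polytope_convex polP (Itv01 p0 p1) (mem_set Pz1) (mem_set Pz2).
by rewrite inE.
Qed.

(** Average, one job at a time, with a rate vector that is positive at that job. Such a [z] lets
    every volume vector be processed in finite time. *)
Lemma polytope_positive : exists2 z, P z & forall j, 0 < z 0 j.
Proof.
suff [z Pz H] : exists2 z, P z & forall j, j \in enum 'I_n -> 0 < z 0 j.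
  by exists z => // j; apply: H; rewrite mem_enum.
elim: (enum 'I_n) => [|i s [z Pz H]]; first by exists 0 => //; exact: polytope0.
have [z' Pz' z'i] := polytope_pos polP i.
exists (2^-1 *: z + (1 - 2^-1) *: z').
  by apply: polytope_conv => //; lra.
have half : 1 - 2^-1 = 2^-1 :> R by lra.
move=> j; rewrite in_cons !mxE half => /orP[/eqP ->|js].
  have := vle_ge0 i (polytope_ge0 polP Pz); lra.
have := vle_ge0 j (polytope_ge0 polP Pz'); have := H j js; lra.
Qed.

Definition rates s D Y : Prop :=
  (forall j, measurable_fun D (fun t => Y t 0 j)) /\
  (forall t, D t -> exists2 z, P z & Y t = s *: z).

Lemma rates_ge0 s D Y t : 0 <= s -> rates s D Y -> D t -> vle 0 (Y t).
Proof.
move=> s0 [_ YP] Dt; have [z Pz ->] := YP _ Dt.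
by apply/vle0P => j; rewrite mxE mulr_ge0// vle_ge0//; exact: (polytope_ge0 polP).
Qed.

Lemma rates_le s D Y t j : 0 <= s -> rates s D Y -> D t ->
  Y t 0 j <= s * support_fun P (const_mx 1).
Proof.
move=> s0 [_ YP] Dt; have [z Pz ->] := YP _ Dt.
by rewrite mxE ler_wpM2l// polytope_bounded.
Qed.

Lemma rates_subset s D D' Y : measurable D -> D' `<=` D -> rates s D Y ->
  rates s D' Y.
Proof.
move=> mD DD' [mY YP]; split=> [j|t /DD' /YP//].
exact: measurable_funS (mY j).
Qed.

Lemma eq_rates s D Y Y' : (forall t, D t -> Y t = Y' t) -> rates s D Y ->
  rates s D Y'.
Proof.
move=> YY' [mY YP]; split=> [j|t Dt]; last by rewrite -YY'//; exact: YP.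
apply: eq_measurable_fun (mY j) => t; rewrite inE => Dt.
by rewrite YY'.
Qed.

Lemma rates_cat s (x y z : itv_bound R) Y : (x <= y)%O -> (y <= z)%O ->
    rates s [set` Interval x y] Y -> rates s [set` Interval y z] Y ->
  rates s [set` Interval x z] Y.
Proof.
move=> xy yz [mY1 YP1] [mY2 YP2]; split=> [j|t].
  by rewrite (itv_bndbnd_setU xy yz); apply/measurable_funU.
by rewrite (itv_bndbnd_setU xy yz) => -[/YP1|/YP2].
Qed.

(** Speeds add up by convexity: the sum is [s1 + s2] times the convex combination with weights
    proportional to the speeds. *)
Lemma rates_add s1 s2 D Y1 Y2 : 0 < s1 -> 0 < s2 ->
  rates s1 D Y1 -> rates s2 D Y2 -> rates (s1 + s2) D (fun t => Y1 t + Y2 t).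
Proof.
move=> s10 s20 [mY1 YP1] [mY2 YP2]; split.
  move=> j; apply: eq_measurable_fun (measurable_funD (mY1 j) (mY2 j)) => t _.
  by rewrite mxE.
move=> t Dt; have [z1 Pz1 ->] := YP1 t Dt; have [z2 Pz2 ->] := YP2 t Dt.
have s12 : 0 < s1 + s2 by rewrite addr_gt0.
exists ((s1 / (s1 + s2)) *: z1 + (1 - s1 / (s1 + s2)) *: z2).
  apply: polytope_conv => //; first by rewrite divr_ge0// ltW.
  by rewrite ler_pdivrMr// mul1r lerDl ltW.
by apply/rowP => j; rewrite !mxE; field; rewrite gt_eqF.
Qed.

Lemma measurable_dot D u Y : (forall j, measurable_fun D (fun t => Y t 0 j)) ->
  measurable_fun D (fun t => dot u (Y t)).
Proof.
move=> mY; apply: measurable_sum => j; exact: measurable_funM.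
Qed.

Lemma has_integral_dot D u Y x : measurable D ->
    (forall j, has_integral D (fun t => Y t 0 j) (x 0 j)) ->
  has_integral D (fun t => dot u (Y t)) (dot u x).
Proof.
by move=> mD Yx; apply: has_integral_sum => // j; exact: has_integralZ.
Qed.

Section cost.
Variable d : 'rV[R]_n.
Hypothesis d0 : vle 0 d.

Definition delay_cost (rho : R) Y (t : R) : R := (t - rho) * dot d (Y t).

Lemma measurable_delay_cost D rho Y :
  (forall j, measurable_fun D (fun t => Y t 0 j)) ->
  measurable_fun D (delay_cost rho Y).
Proof.
move=> mY; apply: measurable_funM; last exact: measurable_dot.
by apply: measurable_funTS; exact: measurable_funB.
Qed.

Lemma delay_cost_ge0 rho Y t : rho <= t -> vle 0 (Y t) -> 0 <= delay_cost rho Y t.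
Proof. by move=> rt Y0; rewrite mulr_ge0 ?subr_ge0// dot_ge0. Qed.

(** Minimizers of the residual program (start 0, speed 1) and tails of schedules are both of this
    form, so that cutting, concatenation, superposition and rescaling are proved once. The cost [c]
    counts delay from [rho]. *)
Definition plan rho s x c Y : Prop :=
  [/\ rates s `[rho, +oo[%classic Y,
      forall j, has_integral `[rho, +oo[%classic (fun t => Y t 0 j) (x 0 j) &
      has_integral `[rho, +oo[%classic (delay_cost rho Y) c].

Lemma in_itvcy (a t : R) : (`[a, +oo[%classic : set R) t <-> a <= t.
Proof. by rewrite /= in_itv/= andbT. Qed.

Lemma in_itvco (a b t : R) : (`[a, b[%classic : set R) t <-> a <= t < b.
Proof. by rewrite /= in_itv/=. Qed.

Lemma plan_ge0 rho s x c Y : 0 <= s -> plan rho s x c Y -> vle 0 x /\ 0 <= c.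
Proof.
move=> s0 [rY Yx Yc]; split.
  apply/vle0P => j; apply: has_integral_ge0 (Yx j) _ => // t Dt.
  by apply: vle_ge0; exact: (rates_ge0 s0 rY Dt).
apply: has_integral_ge0 Yc _ => // t Dt; apply: delay_cost_ge0.
  exact/in_itvcy.
exact: (rates_ge0 s0 rY Dt).
Qed.

Lemma plan0 rho s : plan rho s 0 0 (fun=> 0).
Proof.
split=> [|j|].
- split=> [j|t _]; first exact: measurable_cst.
  by exists 0; [exact: polytope0|rewrite scaler0].
- by rewrite mxE; exact: has_integral0.
- apply: eq_has_integral (has_integral0 _) => // t _.
  by rewrite /delay_cost dot0r mulr0.
Qed.

Lemma window_integrals s (a b : R) Y : 0 <= s -> rates s `[a, b[%classic Y ->
  exists (X : 'rV[R]_n) (m : R),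
    (forall j, has_integral `[a, b[%classic (fun t => Y t 0 j) (X 0 j)) /\
    has_integral `[a, b[%classic (delay_cost a Y) m.
Proof.
move=> s0 rY; pose M := s * support_fun P (const_mx 1).
have fin : (mu `[a, b[%classic < +oo)%E.
  by rewrite lebesgue_measure_itv/=; case: ifP => _; rewrite ?ltry// -EFinD ltry.
have H1 j : exists c, has_integral `[a, b[%classic (fun t => Y t 0 j) c.
  apply: (bounded_has_integral (M := M)) => //; first exact: rY.1.
  move=> t Dt; rewrite ger0_norm; first exact: (rates_le j s0 rY Dt).
  by apply: vle_ge0; exact: (rates_ge0 s0 rY Dt).
have [X hX] := choice H1.
have [m hm] : exists m, has_integral `[a, b[%classic (delay_cost a Y) m.
  apply: (bounded_has_integral (M := (b - a) * (s * support_fun P d))) => //.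
    by apply: measurable_delay_cost; exact: rY.1.
  move=> t Dt; have /in_itvco/andP[at' tb] := Dt.
  rewrite ger0_norm; last by apply: delay_cost_ge0 => //; exact: (rates_ge0 s0 rY Dt).
  have [z Pz YE] := rY.2 t Dt.
  rewrite /delay_cost YE dotZr ler_pM ?subr_ge0 ?lerD2r//.
  - by rewrite mulr_ge0// dot_ge0//; exact: (polytope_ge0 polP).
  - exact: ltW.
  - by rewrite ler_wpM2l//; exact: support_ub.
exists (\row_j X j), m; split=> // j; rewrite mxE; exact: hX.
Qed.

(** Counting the delay of the tail from [T] instead of [rho] saves [T - rho] for each unit of the
    volume [x'] still to be processed. *)
Lemma plan_split rho T s x c Y : rho <= T -> 0 <= s -> plan rho s x c Y ->
  exists (X : 'rV[R]_n) (m : R) (x' : 'rV[R]_n) (c' : R), [/\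
    forall j, has_integral `[rho, T[%classic (fun t => Y t 0 j) (X 0 j),
    has_integral `[rho, T[%classic (delay_cost rho Y) m,
    plan T s x' c' Y, x = X + x' & c = m + (T - rho) * dot d x' + c'].
Proof.
move=> rT s0 [rY Yx Yc].
have b1 : (BLeft rho <= BLeft T)%O by rewrite bnd_simp.
have b2 : (BLeft T <= +oo)%O by [].
have [X hX] := choice (fun j => has_integral_split b1 b2 (Yx j)).
have [x' hx'] := choice hX.
have [m [c2 [hm hc2 ->]]] := has_integral_split b1 b2 Yc.
pose x'v : 'rV[R]_n := \row_j x' j.
have Yx' j : has_integral `[T, +oo[%classic (fun t => Y t 0 j) (x'v 0 j).
  by rewrite mxE; have [] := hx' j.
exists (\row_j X j), m, x'v, (c2 - (T - rho) * dot d x'v); split.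
- by move=> j; rewrite mxE; have [] := hx' j.
- exact: hm.
- split=> //.
    apply: rates_subset rY => // t /in_itvcy Tt; apply/in_itvcy.
    exact: le_trans Tt.
  have mTy : measurable (`[T, +oo[%classic : set R) by [].
  have := has_integralB mTy hc2 (has_integralZ mTy (T - rho) (has_integral_dot d mTy Yx')).
  by apply: eq_has_integral => // t _; rewrite /delay_cost; ring.
- by apply/rowP => j; rewrite !mxE; have [] := hx' j.
- by ring.
Qed.

Lemma plan_cat rho T s (X x' : 'rV[R]_n) m c' Y Y' : rho <= T ->
    rates s `[rho, T[%classic Y ->
    (forall j, has_integral `[rho, T[%classic (fun t => Y t 0 j) (X 0 j)) ->
    has_integral `[rho, T[%classic (delay_cost rho Y) m ->
    plan T s x' c' Y' ->
  plan rho s (X + x') (m + (T - rho) * dot d x' + c')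
    (fun t => if t < T then Y t else Y' t).
Proof.
move=> rT rY YX Ym [rY' Yx' Yc'].
have b1 : (BLeft rho <= BLeft T)%O by rewrite bnd_simp.
have b2 : (BLeft T <= +oo)%O by [].
set Z := (fun t => _).
have ZY t : (`[rho, T[%classic : set R) t -> Y t = Z t.
  by move=> /in_itvco/andP[_ tT]; rewrite /Z tT.
have ZY' t : (`[T, +oo[%classic : set R) t -> Y' t = Z t.
  by move=> /in_itvcy tT; rewrite /Z ltNge tT.
have mTy : measurable (`[T, +oo[%classic : set R) by [].
split.
- by apply: (rates_cat b1 b2); [exact: eq_rates rY|exact: eq_rates rY'].
- move=> j; rewrite mxE; apply: (has_integral_cat b1 b2).
    by apply: eq_has_integral (YX j) => // t /ZY ->.
  by apply: eq_has_integral (Yx' j) => // t /ZY' ->.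
- rewrite -addrA; apply: (has_integral_cat b1 b2).
    by apply: eq_has_integral Ym => // t Dt; rewrite /delay_cost ZY.
  apply: eq_has_integral (has_integralD mTy (has_integralZ mTy (T - rho)
    (has_integral_dot d mTy Yx')) Yc') => // t Dt.
  by rewrite /delay_cost ZY'//; ring.
Qed.

Lemma plan_add rho s1 s2 x1 x2 c1 c2 Y1 Y2 : 0 < s1 -> 0 < s2 ->
    plan rho s1 x1 c1 Y1 -> plan rho s2 x2 c2 Y2 ->
  plan rho (s1 + s2) (x1 + x2) (c1 + c2) (fun t => Y1 t + Y2 t).
Proof.
move=> s10 s20 [rY1 Yx1 Yc1] [rY2 Yx2 Yc2]; split; first exact: rates_add.
- move=> j; rewrite mxE.
  apply: eq_has_integral (has_integralD _ (Yx1 j) (Yx2 j)) => // t _.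
  by rewrite mxE.
- apply: eq_has_integral (has_integralD _ Yc1 Yc2) => // t _.
  by rewrite /delay_cost dotDr mulrDr.
Qed.

Lemma plan_scale rho s x c k Y : plan rho s x c Y ->
  plan rho (k * s) (k *: x) (k * c) (fun t => k *: Y t).
Proof.
move=> [[mY YP] Yx Yc]; split; [split| |].
- move=> j; apply: eq_measurable_fun (measurable_funM (measurable_cst k) (mY j)) => t _.
  by rewrite mxE.
- by move=> t Dt; have [z Pz ->] := YP t Dt; exists z; rewrite // scalerA.
- move=> j; rewrite mxE; apply: eq_has_integral (has_integralZ _ k (Yx j)) => // t _.
  by rewrite mxE.
- apply: eq_has_integral (has_integralZ _ k Yc) => // t _.
  by rewrite /delay_cost dotZr; ring.
Qed.

(** Running [k] times as fast processes the same volumes and divides every delay by [k]. *)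
Lemma plan_time a b s x c k Y : 0 <= s -> 0 < k -> plan a s x c Y ->
  plan b (k * s) x (k^-1 * c) (fun t => k *: Y (a + k * (t - b))).
Proof.
move=> s0 k0 [rY Yx Yc]; have [mY YP] := rY.
have k1 : k != 0 by rewrite gt_eqF.
have ab t : b <= t -> a <= a + k * (t - b).
  by move=> bt; rewrite lerDl mulr_ge0 ?subr_ge0// ltW.
have Y0 t : a <= t -> vle 0 (Y t) by move=> /in_itvcy Dt; exact: (rates_ge0 s0 rY Dt).
split; [split| |].
- move=> j; have := measurable_funM (measurable_cst k)
    (measurable_fun_affine_itv (b := b) k0 (mY j)).
  by apply: eq_measurable_fun => t _; rewrite mxE.
- move=> t /in_itvcy /ab /in_itvcy /YP[z Pz ->].
  by exists z; rewrite // scalerA.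
- move=> j; have H : has_integral `[b, +oo[%classic
      (fun t => Y (a + k * (t - b)) 0 j) (k^-1 * x 0 j).
    apply: (has_integral_affine (g := fun t => Y t 0 j) _ k0 _ (Yx j)) => t /Y0.
    exact: vle_ge0.
  rewrite -(mulVKf k1 (x 0 j)).
  by apply: eq_has_integral (has_integralZ _ k H) => // t _; rewrite mxE.
- have H := has_integral_affine b k0 _ Yc.
  apply: eq_has_integral (H _) => // [t _|t at']; last exact: delay_cost_ge0 (Y0 _ _).
  by rewrite /delay_cost dotZr; ring.
Qed.

End cost.
End plans.

(** * The residual optimum *)

Section residual_value.
Context {R : realType} {n : nat} (P : set 'rV[R]_n).
Hypothesis polP : scheduling_polytope P.
Notation mu := (@lebesgue_measure R).
Variable d : 'rV[R]_n.
Hypothesis d0 : vle 0 d.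
Implicit Types (x y u : 'rV[R]_n) (s c : R).

Lemma residual_costE (z : R -> 'rV[R]_n) : rates P 1 `[0, +oo[%classic z ->
  (residual_cost d z = \int[mu]_(t in `[0%R, +oo[) (delay_cost d 0 z t)%:E)%E.
Proof.
move=> rz; have [mz _] := rz.
have tz0 j t : (`[0, +oo[%classic : set R) t -> 0 <= t * z t 0 j.
  move=> Dt; have t0 := iffLR (in_itvcy _ _) Dt.
  by rewrite mulr_ge0// vle_ge0//; exact: (rates_ge0 polP ler01 rz Dt).
have mtz j : measurable_fun (`[0, +oo[%classic : set R) (fun t => t * z t 0 j).
  exact: measurable_funM.
transitivity (\sum_j \int[mu]_(t in `[0%R, +oo[) (d 0 j * (t * z t 0%R j))%:E)%E.
  apply: eq_bigr => j _; under [RHS]eq_integral do rewrite EFinM.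
  rewrite ge0_integralZl//.
  - by apply/measurable_EFinP; exact: mtz.
  - by move=> t Dt; rewrite lee_fin tz0.
  - by rewrite lee_fin; exact: vle_ge0.
rewrite -ge0_integral_sum//.
- apply: eq_integral => t _; rewrite sumEFin; congr EFin.
  rewrite /delay_cost subr0 /dot mulr_sumr; apply: eq_bigr => j _; ring.
- move=> j; apply/measurable_EFinP.
  exact: measurable_funM (measurable_cst (d 0 j)) (mtz j).
- by move=> j t Dt; rewrite lee_fin mulr_ge0//; [exact: vle_ge0|exact: tz0].
Qed.

Lemma rates1P D (z : R -> 'rV[R]_n) : rates P 1 D z <->
  (forall j, measurable_fun D (fun t => z t 0 j)) /\ (forall t, D t -> P (z t)).
Proof.
split=> -[mz zP]; split=> // t /zP.
  by move=> [z' Pz' ->]; rewrite scale1r.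
by exists (z t); rewrite ?scale1r.
Qed.

Lemma residual_optimum_ge0 x : (0 <= residual_optimum P d x)%E.
Proof.
apply: le_ereal_inf_tmp => _ [z [mz zP _ _] <-].
rewrite residual_costE; last first.
  by apply/rates1P; split=> // t /in_itvcy; exact: zP.
apply: integral_ge0 => t /in_itvcy t0; rewrite lee_fin delay_cost_ge0//.
exact: (polytope_ge0 polP (zP _ t0)).
Qed.

Lemma feasible_plan x c (z : R -> 'rV[R]_n) : residual_feasible P x z ->
  (residual_cost d z = c%:E)%E -> plan P d 0 1 x c z.
Proof.
move=> [mz zP _ zx] zc.
have rz : rates P 1 `[0, +oo[%classic z.
  by apply/rates1P; split=> // t /in_itvcy; exact: zP.
have z0 t : (`[0, +oo[%classic : set R) t -> vle 0 (z t).
  exact: (rates_ge0 polP ler01 rz).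
split=> //.
  by move=> j; apply: ge0_has_integral => // t /z0; exact: vle_ge0.
apply: ge0_has_integral => //.
- exact: measurable_delay_cost.
- by move=> t Dt; apply: delay_cost_ge0 (z0 _ Dt) => //; exact/in_itvcy.
- by rewrite -residual_costE.
Qed.

(** Each job is slowed down by the factor [x' 0 j / x 0 j], which [P] admits because it is downward
    closed. *)
Lemma residual_optimum_le x x' c (z : R -> 'rV[R]_n) : vle 0 x' -> vle x' x ->
  plan P d 0 1 x c z -> (residual_optimum P d x' <= c%:E)%E.
Proof.
move=> x'0 x'x [rz zx zc]; have [mz zP] := (iffLR (rates1P _ _) rz).
have z0 t : (`[0, +oo[%classic : set R) t -> vle 0 (z t).
  exact: (rates_ge0 polP ler01 rz).
(* For [x 0 j = 0] the quotient is 0 by convention, consistent with [x' 0 j = 0]. Where [x' 0 j = 0]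
   the new rate vanishes at every time, as [residual_feasible] demands. *)
pose k j := x' 0 j / x 0 j.
have x0 : vle 0 x by exact: vle_trans x'0 x'x.
have k0 j : 0 <= k j by rewrite divr_ge0// vle_ge0.
have k1 j : k j <= 1.
  have [xj|xj] := eqVneq (x 0 j) 0; first by rewrite /k xj invr0 mulr0.
  by rewrite ler_pdivrMr ?mul1r// lt_neqAle eq_sym xj vle_ge0.
have kx j : k j * x 0 j = x' 0 j.
  have [xj|xj] := eqVneq (x 0 j) 0; last by rewrite /k divfK.
  rewrite xj mulr0; apply/eqP; rewrite eq_le vle_ge0//=.
  by have := x'x j; rewrite xj.
pose z' t : 'rV[R]_n := \row_j (k j * z t 0 j).
have z'0 t : (`[0, +oo[%classic : set R) t -> vle 0 (z' t).
  by move=> /z0 zt0; apply/vle0P => j; rewrite mxE mulr_ge0// vle_ge0.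
have z'z t : (`[0, +oo[%classic : set R) t -> vle (z' t) (z t).
  by move=> /z0 zt0 j; rewrite mxE ler_piMl// vle_ge0.
have rz' : rates P 1 `[0, +oo[%classic z'.
  apply/rates1P; split=> [j|t Dt].
    apply: eq_measurable_fun (measurable_funM (measurable_cst (k j)) (mz j)) => t _.
    by rewrite mxE.
  exact: (polytope_down polP (z'0 _ Dt) (z'z _ Dt) (zP _ Dt)).
have z'x' j : has_integral `[0, +oo[%classic (fun t => z' t 0 j) (x' 0 j).
  rewrite -kx; apply: eq_has_integral (has_integralZ _ (k j) (zx j)) => // t _.
  by rewrite mxE.
have dle t : (`[0, +oo[%classic : set R) t -> delay_cost d 0 z' t <= delay_cost d 0 z t.
  move=> Dt; rewrite ler_wpM2l ?subr_ge0//; first exact/in_itvcy.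
  by apply: ler_dotr => //; exact: z'z.
have dge t : (`[0, +oo[%classic : set R) t -> 0 <= delay_cost d 0 z' t.
  by move=> Dt; apply: delay_cost_ge0 (z'0 _ Dt) => //; exact/in_itvcy.
have mdz' := measurable_delay_cost d 0 rz'.1.
have [b hb] : exists b, has_integral `[0, +oo[%classic (delay_cost d 0 z') b.
  apply: (dominated_has_integral _ mdz' zc) => // t Dt.
  by rewrite ger0_norm ?dge// dle.
have bc : b <= c := le_has_integral (measurable_itv _) hb zc dle.
apply: (@le_trans _ _ b%:E); last by rewrite lee_fin.
apply: ereal_inf_lbound; exists z'.
  split=> //.
  - by move=> j; exact: rz'.1.
  - by move=> t t0; apply: (iffLR (rates1P _ _) rz').2; exact/in_itvcy.
  - by move=> j xj t t0; rewrite mxE /k xj !mul0r.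
  - by move=> j; exact: has_integralE.
by rewrite residual_costE//; exact: has_integralE.
Qed.

Lemma plan_exists x : vle 0 x -> exists c z, plan P d 0 1 x c z.
Proof.
move=> x0; have [zb Pzb zb0] := polytope_positive polP.
(* Long enough for the constant rates [T^-1 *: x] to stay below [zb]; the summand 1 makes it
   positive even for [x = 0]. *)
pose T := 1 + \sum_j x 0 j / zb 0 j.
have T1 : 1 <= T.
  by rewrite lerDl sumr_ge0// => j _; rewrite divr_ge0//; [exact: vle_ge0|exact: ltW].
have T0 : 0 < T by exact: lt_le_trans T1.
have xT : vle (T^-1 *: x) zb.
  move=> j; rewrite mxE mulrC ler_pdivrMr// mulrC -ler_pdivrMr//.
  rewrite /T (bigD1 j)//= addrCA lerDl addr_ge0// sumr_ge0// => i _.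
  by rewrite divr_ge0//; [exact: vle_ge0|exact: ltW].
have xT0 : vle 0 (T^-1 *: x).
  by apply/vle0P => j; rewrite mxE mulr_ge0 ?vle_ge0// invr_ge0 ltW.
have rY : rates P 1 `[0, T[%classic (fun=> T^-1 *: x).
  apply/rates1P; split=> [j|t _]; first exact: measurable_cst.
  exact: (polytope_down polP xT0 xT Pzb).
have [X [m [hX hm]]] := window_integrals polP d0 ler01 rY.
have XE : X = x.
  apply/rowP => j; have := has_integral_cst ((T^-1 *: x) 0 j) (ltW T0).
  move/(has_integral_unique (hX j)) ->.
  by rewrite mxE subr0 mulrAC mulVf ?mul1r// gt_eqF.
have := plan_cat (ltW T0) rY hX hm (plan0 polP d T 1).
rewrite XE addr0 => pl; do 2 eexists; exact: pl.
Qed.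

Definition residual_value x : R := fine (residual_optimum P d x).

Lemma residual_optimumE x : vle 0 x -> residual_optimum P d x = (residual_value x)%:E.
Proof.
move=> x0; rewrite fineK// ge0_fin_numE ?residual_optimum_ge0//.
have [c [z pl]] := plan_exists x0.
exact: le_lt_trans (residual_optimum_le x0 (vle_refl x) pl) (ltry c).
Qed.

Lemma residual_value_ge0 x : 0 <= residual_value x.
Proof. exact: fine_ge0 (residual_optimum_ge0 x). Qed.

Lemma residual_value_le rho s x x' c Y : 0 < s -> vle 0 x' -> vle x' x ->
  plan P d rho s x c Y -> residual_value x' <= s * c.
Proof.
move=> s0 x'0 x'x /(plan_time polP d0 0 (ltW s0) (k := s^-1)) pl.
have si0 : 0 < s^-1 by rewrite invr_gt0.
have := residual_optimum_le x'0 x'x (_ : plan P d 0 1 x (s * c) _).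
have := pl si0; rewrite mulVf ?gt_eqF// invrK => pl'.
by move=> /(_ _ pl'); rewrite residual_optimumE// lee_fin.
Qed.


Hypothesis attP : residual_attained P.

Lemma minimizer_plan x (z : R -> 'rV[R]_n) : vle 0 x ->
  residual_minimizer P d x z -> plan P d 0 1 x (residual_value x) z.
Proof.
by move=> x0 [fz zE]; apply: feasible_plan => //; rewrite zE residual_optimumE.
Qed.

Lemma minimizer_speed_plan rho s x (z : R -> 'rV[R]_n) : vle 0 x -> 0 < s ->
    residual_minimizer P d x z ->
  plan P d rho s x (residual_value x / s) (fun t => s *: z (s * (t - rho))).
Proof.
move=> x0 s0 /(minimizer_plan x0)/(plan_time polP d0 rho ler01 s0).
rewrite mulr1 mulrC; congr (plan _ _ _ _ _ _ _).
by apply/funext => t; rewrite add0r.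
Qed.

Lemma residual_value_plan rho s x : vle 0 x -> 0 < s ->
  exists Y, plan P d rho s x (residual_value x / s) Y.
Proof.
move=> x0 s0; have [z zmin] := attP d0 x0.
by eexists; exact: minimizer_speed_plan zmin.
Qed.

Lemma residual_value_mono x y : vle 0 x -> vle x y ->
  residual_value x <= residual_value y.
Proof.
move=> x0 xy; have [Y pl] := residual_value_plan 0 (vle_trans x0 xy) ltr01.
by have := residual_value_le ltr01 x0 xy pl; rewrite divr1 mul1r.
Qed.

Lemma residual_value0 : residual_value 0 = 0.
Proof.
apply/eqP; rewrite eq_le residual_value_ge0 andbT.
have := residual_value_le ltr01 (vle_refl 0) (vle_refl 0) (plan0 polP d 0 1).
by rewrite mulr0.
Qed.

(** Minimizers for [x] and [y], scaled by [p] and [1 - p], superpose to a plan of speed 1. The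
    extreme values of [p] are split off because superposition asks for positive speeds. *)
Lemma residual_value_convex x y (p : R) : vle 0 x -> vle 0 y -> 0 <= p -> p <= 1 ->
  residual_value (p *: x + (1 - p) *: y) <=
  p * residual_value x + (1 - p) * residual_value y.
Proof.
move=> x0 y0 p0 p1.
have [->|pn0] := eqVneq p 0.
  by rewrite scale0r mul0r !add0r subr0 scale1r mul1r.
have [->|pn1] := eqVneq p 1.
  by rewrite subrr scale0r mul0r !addr0 scale1r mul1r.
have pp : 0 < p by rewrite lt_neqAle eq_sym pn0.
have qp : 0 < 1 - p by rewrite subr_gt0 lt_neqAle pn1.
have [X plX] := residual_value_plan 0 x0 ltr01.
have [Y plY] := residual_value_plan 0 y0 ltr01.
have ppr : 0 < p * 1 by rewrite mulr1.
have qpr : 0 < (1 - p) * 1 by rewrite mulr1.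
have := plan_add polP ppr qpr (plan_scale p plX) (plan_scale (1 - p) plY).
rewrite !mulr1 subrKC !divr1 => pl.
have xy0 : vle 0 (p *: x + (1 - p) *: y).
  by apply/vle0P => j; rewrite !mxE addr_ge0// mulr_ge0 ?vle_ge0// ltW.
by have := residual_value_le ltr01 xy0 (vle_refl _) pl; rewrite mul1r.
Qed.

Lemma residual_value_subgradient x : vle 0 x ->
  exists l, forall y, vle 0 y ->
    residual_value x + dot l (y - x) <= residual_value y.
Proof.
move=> x0; apply: convex_subgradient_orthant => //.
  by move=> *; exact: residual_value_convex.
by move=> *; exact: residual_value_mono.
Qed.

End residual_value.

(** * Supermodularity of the residual optimum *)

Section supermodularity.
Context {R : realType} {n : nat} (P : set 'rV[R]_n).
Hypothesis polP : scheduling_polytope P.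
Notation mu := (@lebesgue_measure R).
Variable d : 'rV[R]_n.
Hypothesis d0 : vle 0 d.
Implicit Types (x y a b e l u : 'rV[R]_n).

(** By monotone convergence the integrals over [[x0, x0 + k + 1)] tend to [c], so they cannot all
    stay below [c - eta]. *)
Lemma has_integral_tail (g : R -> R) (x0 c eta : R) : 0 < eta ->
    (forall t, x0 <= t -> 0 <= g t) -> has_integral `[x0, +oo[%classic g c ->
  exists2 T : R, x0 < T &
    forall r : R, has_integral `[T, +oo[%classic g r -> r <= eta.
Proof.
move=> eta0 g0 gc; apply: contrapT => noT.
pose F (k : nat) : set R := `[x0, x0 + k.+1%:R[%classic.
have FU : \bigcup_k F k = `[x0, +oo[%classic.
  apply/seteqP; split=> [t [k _ /in_itvco/andP[t0 _]]|t /in_itvcy t0].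
    exact/in_itvcy.
  exists (Num.truncn (t - x0)) => //; apply/in_itvco; rewrite t0/=.
  by rewrite -ltrBlDl truncnS_gt.
have Fg k : (\int[mu]_(t in F k) (g t)%:E <= (c - eta)%:E)%E.
  have b1 : (BLeft x0 <= BLeft (x0 + k.+1%:R))%O by rewrite bnd_simp lerDl.
  have b2 : (BLeft (x0 + k.+1%:R) <= +oo)%O by [].
  have [c1 [c2 [h1 h2 cE]]] := has_integral_split b1 b2 gc.
  rewrite (has_integralE _ h1)// lee_fin leNgt; apply/negP => c1c.
  apply: noT; exists (x0 + k.+1%:R) => [|r hr]; first by rewrite ltrDl.
  have := has_integral_unique hr h2; lra.
have mg : measurable_fun (`[x0, +oo[%classic : set R) (EFin \o g).
  by apply/measurable_EFinP; exact: has_integral_measurable gc.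
have Fy k : F k `<=` `[x0, +oo[%classic.
  by move=> t /in_itvco/andP[t0 _]; exact/in_itvcy.
have cE : (\int[mu]_(x in F i) (EFin \o g) x)%E @[i --> \oo] --> c%:E.
  rewrite -(has_integralE _ gc)// -FU.
  apply: ge0_nondecreasing_set_cvg_integral => [i j ij|i|i|i t Ft].
  - apply/subsetPset => t /in_itvco/andP[t0 ti]; apply/in_itvco; rewrite t0/=.
    by apply: lt_le_trans ti _; rewrite lerD2l ler_nat ltnS.
  - exact: measurable_itv.
  - exact: measurable_funS (Fy i) mg.
  - by rewrite lee_fin; apply: g0; apply/in_itvcy; exact: Fy Ft.
have : (c%:E <= (c - eta)%:E)%E.
  rewrite -(cvg_lim _ cE)//; apply: lime_le; first exact: cvgP cE.
  by apply: nearW => k; exact: Fg.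
by rewrite lee_fin; lra.
Qed.

(** A maximizer of [l - t *: d] is kept fixed over a step of length [r], which costs at most
    [r * support_fun P d]. Step functions avoid a measurable selection of maximizers. *)
Lemma near_maximizing_rates (l : 'rV[R]_n) (T eta : R) : 0 < T -> 0 < eta ->
  exists2 Y, rates P 1 `[0, T[%classic Y &
    forall t, 0 <= t < T ->
      support_fun P (l - t *: d) <= dot (l - t *: d) (Y t) + eta.
Proof.
move=> T0 eta0; pose h := support_fun P d.
have h0 : 0 <= h by exact: support_ge0.
pose N := (Num.truncn (T * h / eta)).+1.
have N0 : (0 : R) < N%:R by rewrite ltr0n.
pose r := T / N%:R.
have r0 : 0 < r by rewrite divr_gt0.
have rh : r * h <= eta.
  by rewrite /r mulrAC ler_pdivrMr// [leRHS]mulrC -ler_pdivrMr// ltW// truncnS_gt.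
suff H (i : nat) : exists2 Y, rates P 1 `[0, r * i%:R[%classic Y &
    forall t, 0 <= t < r * i%:R ->
      support_fun P (l - t *: d) <= dot (l - t *: d) (Y t) + eta.
  by have := H N; rewrite /r divfK// gt_eqF.
elim: i => [|i [Y rY Yh]].
  exists (fun=> 0); last by move=> t; rewrite mulr0 => /andP[/le_lt_trans h1 /h1]; rewrite ltxx.
  rewrite mulr0; apply/rates1P; split=> [j|t /in_itvco/andP[]].
    exact: measurable_cst.
  by move=> /le_lt_trans h1 /h1; rewrite ltxx.
have [z Pz zE] := support_funP polP (l - (r * i%:R) *: d).
have b1 : (BLeft (0 : R) <= BLeft (r * i%:R))%O by rewrite bnd_simp mulr_ge0// ltW.
have b2 : (BLeft (r * i%:R) <= BLeft (r * i.+1%:R))%O.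
  by rewrite bnd_simp ler_pM2l// ler_nat.
exists (fun t => if t < r * i%:R then Y t else z).
  apply: (rates_cat b1 b2).
    by apply: eq_rates rY => t /in_itvco/andP[_ ->].
  apply: (@eq_rates _ _ _ _ _ (fun=> z)).
    by move=> t /in_itvco/andP[it _]; rewrite ltNge it.
  by apply/rates1P; split=> [j|//]; exact: measurable_cst.
move=> t /andP[t0 ti]; case: ltP => it; first by apply: Yh; rewrite t0.
have le1 : support_fun P (l - t *: d) <= support_fun P (l - (r * i%:R) *: d).
  apply: le_support => // j; rewrite !mxE lerD2l lerN2 ler_wpM2r//.
  exact: vle_ge0.
apply: (le_trans le1); rewrite -zE !dotBl !dotZl.
have := support_ub polP d Pz; rewrite -/h.
have := dot_ge0 d0 (polytope_ge0 polP Pz).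
move: ti; rewrite -natr1 mulrDr mulr1 => ti dz0 dzh.
have : (t - r * i%:R) * dot d z <= r * h.
  by apply: ler_pM => //; lra.
move=> /le_trans/(_ rh); rewrite mulrBl.
by move: (t * dot d z) (r * i%:R * dot d z) (dot l z) => p q w; lra.
Qed.

Hypothesis attP : residual_attained P.
Hypothesis lsP : forall c, vle 0 c -> linear_substitute (rate_value P c).
Notation f := (residual_value P d).

Lemma window_lagrangian (T m : R) (Y : R -> 'rV[R]_n) (W l : 'rV[R]_n) :
    (forall j, has_integral `[0, T[%classic (fun t => Y t 0 j) (W 0 j)) ->
    has_integral `[0, T[%classic (delay_cost d 0 Y) m ->
  has_integral `[0, T[%classic (fun t => - dot (l - t *: d) (Y t)) (m - dot l W).
Proof.
move=> YW Ym.
have := has_integralB (measurable_itv _) Ym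
  (has_integral_dot l (measurable_itv _) YW).
apply: eq_has_integral => // t _.
by rewrite /delay_cost dotBl dotZl subr0 opprB.
Qed.

(* Lagrangian duality: with multipliers [l] and [u] supporting [f] at [a] and
   [b], the maximum and the minimum of [l] and [u] are feasible multipliers at
   the maximum and the minimum of [a] and [b], and the dual objective is
   submodular in the multipliers because the support function of [P] is. *)
Lemma residual_value_supermodular a b : vle 0 a -> vle 0 b ->
  f a + f b <= f (vmax a b) + f (vmin a b).
Proof.
move=> a0 b0; apply/ler_addgt0Pr => eta eta0.
have [l lP] := residual_value_subgradient polP d0 attP a0.
have [u uP] := residual_value_subgradient polP d0 attP b0.
set L := vmax l u; set M := vmin l u.
have A0 : vle 0 (vmax a b).
  by apply/vle0P => j; rewrite mxE le_max vle_ge0.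
have B0 : vle 0 (vmin a b).
  by apply/vle0P => j; rewrite mxE le_min !vle_ge0.
have [z1 pl1] := residual_value_plan polP d0 attP 0 A0 ltr01.
have [z2 pl2] := residual_value_plan polP d0 attP 0 B0 ltr01.
rewrite !divr1 in pl1 pl2.
(* Multipliers may be negative, while [has_integral_tail] is for nonnegative integrands; hence
   absolute values. *)
pose av (w : 'rV[R]_n) : 'rV[R]_n := \row_j `|w 0 j|.
have av0 w : vle 0 (av w) by apply/vle0P => j; rewrite mxE.
have avle w : vle w (av w) by move=> j; rewrite mxE ler_norm.
pose g t := dot (av L) (z1 t) + dot (av M) (z2 t).
have eta2 : 0 < eta / 2 by rewrite divr_gt0.
have mpos := measurable_itv `[(0 : R), +oo[.
have g0 t : 0 <= t -> 0 <= g t.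
  move=> /in_itvcy Dt; apply: addr_ge0; apply: dot_ge0 => //.
    by case: pl1 => r1 _ _; exact: (rates_ge0 polP ler01 r1 Dt).
  by case: pl2 => r2 _ _; exact: (rates_ge0 polP ler01 r2 Dt).
have gc : has_integral `[0, +oo[%classic g
    (dot (av L) (vmax a b) + dot (av M) (vmin a b)).
  case: pl1 => _ h1 _; case: pl2 => _ h2 _.
  exact: has_integralD (has_integral_dot _ _ h1) (has_integral_dot _ _ h2).
have [T T0 Tg] := has_integral_tail eta2 g0 gc.
have [W1 [m1 [A' [c1 [hW1 hm1 plA' AE cE1]]]]] := plan_split (ltW T0) ler01 pl1.
have [W2 [m2 [B' [c2 [hW2 hm2 plB' BE cE2]]]]] := plan_split (ltW T0) ler01 pl2.
have [A'0 c10] := plan_ge0 polP d0 ler01 plA'.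
have [B'0 c20] := plan_ge0 polP d0 ler01 plB'.
have tail : dot L A' + dot M B' <= eta / 2.
  apply: (@le_trans _ _ (dot (av L) A' + dot (av M) B')).
    by apply: lerD; apply: ler_dotl.
  apply: Tg; have mT := measurable_itv `[T, +oo[.
  case: plA' => _ hA _; case: plB' => _ hB _.
  exact: has_integralD (has_integral_dot _ _ hA) (has_integral_dot _ _ hB).
(* One half of [eta] pays for the tail after [T]. The other half is lost by the two families of
   near-maximizing rates, [eta'] each per unit of time. *)
pose eta' := eta / (4 * T).
have T4 : 0 < 4 * T by rewrite mulr_gt0.
have eta'0 : 0 < eta' by rewrite divr_gt0.
have eta'T : 2 * eta' * T = eta / 2.
  by rewrite /eta'; field; rewrite gt_eqF.
have [y1 ry1 y1P] := near_maximizing_rates l T0 eta'0.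
have [y2 ry2 y2P] := near_maximizing_rates u T0 eta'0.
(* The rates [y] on [[0, T)] process some volumes [W] at cost [m], so [f W <= m]; comparing [W] with
   [w] through the subgradient [k] bounds [f w - dot k w] by the Lagrangian of [y]. *)
have bound k (y : R -> 'rV[R]_n) (w c : 'rV[R]_n) : vle 0 w ->
    (forall y', vle 0 y' -> f w + dot k (y' - w) <= f y') ->
    rates P 1 `[0, T[%classic y -> exists m W, [/\
      has_integral `[0, T[%classic (fun t => - dot (k - t *: d) (y t)) (m - dot k W)
      & f w - dot k w <= m - dot k W].
  move=> w0 kP ry; have [W [m [hW hm]]] := window_integrals polP d0 ler01 ry.
  exists m, W; split; first exact: window_lagrangian.
  have W0 : vle 0 W.
    apply/vle0P => j; apply: has_integral_ge0 (hW j) _ => // t Dt.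
    by apply: vle_ge0; exact: (rates_ge0 polP ler01 ry Dt).
  have := kP _ W0.
  have := plan_cat (ltW T0) ry hW hm (plan0 polP d T 1).
  move=> /(residual_value_le polP d0 ltr01 W0 (x' := W)).
  rewrite !addr0 dot0r mulr0 !addr0 mul1r dotBr => /(_ (vle_refl _)); lra.
have [n1 [Y1 [hY1 fa]]] := bound l y1 a a a0 lP ry1.
have [n2 [Y2 [hY2 fb]]] := bound u y2 b b b0 uP ry2.
have mT := measurable_itv `[(0 : R), T[.
have hZ := has_integralD mT (window_lagrangian L hW1 hm1) (window_lagrangian M hW2 hm2).
have hY := has_integralB mT (has_integralD mT hY1 hY2)
  (has_integral_cst (2 * eta') (ltW T0)).
have := le_has_integral mT hY hZ; rewrite subr0 eta'T => /(_ _) pw.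
have {}pw : n1 - dot l Y1 + (n2 - dot u Y2) - eta / 2 <=
    m1 - dot L W1 + (m2 - dot M W2).
  apply: pw => t Dt; have tT := iffLR (in_itvco _ _ _) Dt.
  have Pz1 : P (z1 t).
    case: pl1 => /rates1P[_ h] _ _; apply: h; apply/in_itvcy.
    by case/andP: tT.
  have Pz2 : P (z2 t).
    case: pl2 => /rates1P[_ h] _ _; apply: h; apply/in_itvcy.
    by case/andP: tT.
  have := support_ub polP (L - t *: d) Pz1.
  have := support_ub polP (M - t *: d) Pz2.
  have := y1P t tT; have := y2P t tT.
  have := support_submodular polP lsP (l - t *: d) (u - t *: d).
  have -> : vmax (l - t *: d) (u - t *: d) = L - t *: d.
    by apply/rowP => j; rewrite !mxE addr_maxl.
  have -> : vmin (l - t *: d) (u - t *: d) = M - t *: d.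
    by apply/rowP => j; rewrite !mxE addr_minl.
  lra.
have := dot_max_min l u a b; rewrite -/L -/M.
have := dot_ge0 d0 A'0; have := dot_ge0 d0 B'0.
move=> dB dA; have TdA := mulr_ge0 (ltW T0) dA; have TdB := mulr_ge0 (ltW T0) dB.
rewrite AE BE !dotDr in cE1 cE2 *; rewrite !subr0 in cE1 cE2; lra.
Qed.

(** Convexity gives [2 * (f (x + e) - f x) <= f (x + 2 *: e) - f x]. Supermodularity at [x + 2 *: e]
    and [x + y] then adds [y]: since [e] is disjoint from [x] and [y], their maximum is
    [x + y + 2 *: e] and their minimum [x]. *)
Lemma residual_value_arrival x y e : vle 0 x -> vle 0 y -> vle 0 e ->
    (forall j, e 0 j = 0 \/ x 0 j = 0 /\ y 0 j = 0) ->
  2 * (f (x + e) - f x) <= f (x + y + 2 *: e) - f (x + y).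
Proof.
move=> x0 y0 e0 disj.
have e20 : vle 0 (2 *: e) by apply/vle0P => j; rewrite mxE mulr_ge0// vle_ge0.
have xe0 : vle 0 (x + 2 *: e) by exact: vleD0.
have := residual_value_supermodular xe0 (vleD0 x0 y0).
have -> : vmax (x + 2 *: e) (x + y) = x + y + 2 *: e.
  apply/rowP => j; rewrite !mxE; have := vle_ge0 j y0; have := vle_ge0 j e0.
  by case: (disj j) => [->|[-> ->]] ? ?; [rewrite max_r|rewrite max_l]; lra.
have -> : vmin (x + 2 *: e) (x + y) = x.
  apply/rowP => j; rewrite !mxE; have := vle_ge0 j y0; have := vle_ge0 j e0.
  by case: (disj j) => [->|[-> ->]] ? ?; [rewrite min_l|rewrite min_r]; lra.
have := @residual_value_convex _ _ _ polP _ d0 attP x (x + 2 *: e) 2^-1 x0 xe0.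
have -> : 2^-1 *: x + (1 - 2^-1) *: (x + 2 *: e) = x + e.
  by apply/rowP => j; rewrite !mxE; field.
by move=> /(_ _ _); lra.
Qed.

End supermodularity.

(** * Evolution of the remaining sizes *)

Section instances.
Context {R : realType} {n : nat} (P : set 'rV[R]_n).
Hypothesis polP : scheduling_polytope P.
Notation mu := (@lebesgue_measure R).
Variable I : instance R n.
Notation d := (density I).
Implicit Types (Z : R -> 'rV[R]_n) (t rho T s : R) (j : 'I_n).

Lemma densityE j : density I 0 j =
  if j \in jobs I then weight I j / job_size I j else 0.
Proof. by rewrite mxE. Qed.

Lemma density_ge0 : vle 0 (density I).
Proof.
apply/vle0P => j; rewrite densityE; case: ifP => // jI.
by rewrite divr_ge0 ?weight_ge0// ltW// job_size_gt0.
Qed.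

(** The times from which the evolution is followed up to the next arrival. Times before all arrivals
    are included to give inductions a start. *)
Definition checkpoint t : Prop :=
  (exists2 i, i \in jobs I & release I i = t) \/ forall j, ~~ arrived I t j.

Definition quiet rho T : Prop :=
  forall j, j \in jobs I -> release I j <= rho \/ T <= release I j.

Lemma last_checkpoint t : exists rho, [/\ rho <= t, checkpoint rho &
  forall j, arrived I t j -> release I j <= rho].
Proof.
have [[i ti]|no] := pselect (exists i, arrived I t i); last first.
  exists t; split=> //; last by move=> j tj; exfalso; apply: no; exists j.
  by right=> j; apply/negP => tj; apply: no; exists j.
have := @arg_maxP _ _ _ i (arrived I t) (release I) ti.
case=> k /andP[kI kt] kmax.
by exists (release I k); split=> //; left; exists k.
Qed.

Lemma final_checkpoint : exists rho, checkpoint rho /\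
  forall j, j \in jobs I -> release I j <= rho.
Proof.
pose t := \sum_(j in jobs I) `|release I j|.
have tP j : j \in jobs I -> release I j <= t.
  move=> jI; rewrite /t (bigD1 j)//= (le_trans (ler_norm _))// lerDl sumr_ge0//.
have [rho [_ rP rmax]] := last_checkpoint t.
by exists rho; split=> // j jI; apply: rmax; rewrite /arrived jI tP.
Qed.

(** Induction on the number of jobs released strictly before [T]; the step goes from the last such
    release to [T]. *)
Lemma checkpoint_ind (Q : R -> Prop) :
    (forall rho, (forall j, ~~ arrived I rho j) -> Q rho) ->
    (forall rho T, rho < T -> checkpoint rho -> quiet rho T -> Q rho -> Q T) ->
  forall T, Q T.
Proof.
move=> Q0 QS T; pose B t := fun j => (j \in jobs I) && (release I j < t).
have [k] := ubnP #|B T|; elim: k T => // k IH T Bk.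
have [[i iT]|no] := pselect (exists i, B T i); last first.
  have nT j : j \in jobs I -> T <= release I j.
    move=> jI; rewrite leNgt; apply/negP => jT; apply: no; exists j.
    by rewrite /B jI.
  have n1 j : ~~ arrived I (T - 1) j.
    apply/negP => /andP[/nT h1 h2]; have := le_trans h1 h2; lra.
  (* Jobs may be released at [T] itself, so [Q0] may fail to apply at [T]; at [T - 1] nothing has
     arrived. *)
  apply: (QS (T - 1)); last exact: Q0.
  - lra.
  - by right.
  - by move=> j /nT; right.
have [m mB mmax] := @arg_maxP _ _ _ i (B T) (release I) iT.
have /andP[mI mT] := mB.
apply: (QS (release I m)) => //.
- by left; exists m.
- move=> j jI; have [jT|] := ltP (release I j) T; last by right.
  by left; apply: mmax; rewrite /B jI.
apply: IH; rewrite -ltnS; apply: leq_trans Bk; rewrite ltnS; apply: proper_card.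
apply/properP; split.
  apply/fintype.subsetP => j; rewrite !unfold_in => /andP[jI jm].
  by rewrite /B jI (lt_trans jm).
by exists m; rewrite unfold_in /B mI// ltxx.
Qed.

(** [feasible] without completion of the jobs, which for gradient descent is derived only from its
    behaviour after the last arrival. *)
Definition proper_schedule s Z : Prop :=
  rates P s [set: R] Z /\ forall t j, ~~ arrived I t j -> Z t 0 j = 0.

Lemma feasible_proper s Z : feasible P s I Z -> proper_schedule s Z.
Proof. by move=> [mZ ZP Z0 _]; split=> //; split=> // t _; exact: ZP. Qed.

Section proper.
Variables (s : R) (Z : R -> 'rV[R]_n).
Hypotheses (s0 : 0 <= s) (pZ : proper_schedule s Z).

Lemma proper_rates D : measurable D -> rates P s D Z.
Proof. by move=> mD; apply: rates_subset pZ.1. Qed.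

Lemma proper_ge0 t : vle 0 (Z t).
Proof. exact: (rates_ge0 polP s0 pZ.1 (Logic.I : [set: R] t)). Qed.

Lemma proper_window (a b : R) j :
  exists c, has_integral `[a, b[%classic (fun t => Z t 0 j) c.
Proof.
have [X [m [hX _]]] := window_integrals polP density_ge0 s0
  (proper_rates (measurable_itv `[a, b[)).
by exists (X 0 j).
Qed.

Lemma remainingE t j c : arrived I t j ->
    has_integral `[release I j, t[%classic (fun t => Z t 0 j) c ->
  remaining I Z t 0 j = job_size I j - c.
Proof.
move=> tj [hc <-]; rewrite mxE tj; congr (_ - _).
by rewrite [RHS]Rintegral_itv_bndo_bndc.
Qed.

Lemma remaining_notin t j : ~~ arrived I t j -> remaining I Z t 0 j = 0.
Proof. by move=> /negbTE tj; rewrite mxE tj. Qed.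

Lemma window_zero rho T j c : T <= release I j ->
  has_integral `[rho, T[%classic (fun t => Z t 0 j) c -> c = 0.
Proof.
move=> Tj hc; apply: has_integral_unique hc _.
apply: eq_has_integral (has_integral0 _) => //.
move=> t /in_itvco/andP[_ tT]; rewrite pZ.2//; apply/negP => /andP[_].
by rewrite leNgt (lt_le_trans tT Tj).
Qed.

Definition arriving T : 'rV[R]_n :=
  \row_j (if (j \in jobs I) && (release I j == T) then job_size I j else 0).

Lemma arriving_ge0 T : vle 0 (arriving T).
Proof.
apply/vle0P => j; rewrite mxE; case: ifP => // /andP[jI _].
by rewrite ltW// job_size_gt0.
Qed.

Lemma remaining_step rho T (W : 'rV[R]_n) : rho < T -> quiet rho T ->
    (forall j, has_integral `[rho, T[%classic (fun t => Z t 0 j) (W 0 j)) ->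
  remaining I Z T = remaining I Z rho - W + arriving T.
Proof.
move=> rT q hW; apply/rowP => j.
have -> : (remaining I Z rho - W + arriving T) 0 j =
    remaining I Z rho 0 j - W 0 j + arriving T 0 j.
  by move: (remaining I Z rho) (arriving T) => x y; rewrite !mxE.
rewrite [arriving T 0 j]mxE.
have [jI|jI] /= := boolP (j \in jobs I); last first.
  have nt t : ~~ arrived I t j by rewrite /arrived (negbTE jI).
  rewrite !remaining_notin// (_ : W 0 j = 0) ?subr0 ?addr0//.
  apply: has_integral_unique (hW j) _.
  apply: eq_has_integral (has_integral0 _) => //.
  by move=> t _; rewrite pZ.2.
have [jr|Tj] := q j jI; last first.
  have nr : ~~ arrived I rho j.
    by rewrite /arrived jI/= -ltNge; exact: lt_le_trans Tj.
  rewrite (window_zero Tj (hW j)) (remaining_notin nr) subr0 add0r.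
  have [jT|jT] := eqVneq (release I j) T; last first.
    by rewrite remaining_notin// /arrived jI/= -ltNge lt_neqAle eq_sym jT.
  have [c hc] := proper_window (release I j) T j.
  rewrite (remainingE _ hc) ?(window_zero Tj hc) ?subr0//.
  by rewrite /arrived jI jT lexx.
have -> : (release I j == T) = false by rewrite lt_eqF// (le_lt_trans jr).
have [c hc] := proper_window (release I j) rho j.
have b1 : (BLeft (release I j) <= BLeft rho)%O by rewrite bnd_simp.
have b2 : (BLeft rho <= BLeft T)%O by rewrite bnd_simp ltW.
rewrite (remainingE _ (has_integral_cat b1 b2 hc (hW j))).
  rewrite (remainingE _ hc); first by ring.
  by rewrite /arrived jI.
by rewrite /arrived jI (le_trans jr)// ltW.
Qed.

(* The second summand is what the volume of job [j] that is still unprocessed at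
   time [T] has waited so far. *)
Definition accrued T : R := \sum_j d 0 j *
  (\int[mu]_(t in `[release I j, T[) ((t - release I j) * Z t 0 j) +
   (T - release I j) * remaining I Z T 0 j).

Lemma proper_moment (c a b : R) j :
  exists m, has_integral `[a, b[%classic (fun t => (t - c) * Z t 0 j) m.
Proof.
have fin : (mu `[a, b[%classic < +oo)%E.
  by rewrite lebesgue_measure_itv/=; case: ifP => _; rewrite ?ltry// -EFinD ltry.
have [mZ _] := proper_rates (measurable_itv `[a, b[).
apply: (bounded_has_integral
  (M := (`|a - c| + `|b - c|) * (s * support_fun P (const_mx 1)))) => //.
  apply: measurable_funM => //; apply: measurable_funTS.
  exact: measurable_funB.
move=> t /in_itvco/andP[at' tb]; rewrite normrM ler_pM//.
  by rewrite ler_norml; apply/andP; split;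
    [have := ler_norm (- (a - c)); have := normr_ge0 (b - c); rewrite normrN; lra
    |have := ler_norm (b - c); have := normr_ge0 (a - c); lra].
rewrite ger0_norm; last exact: vle_ge0 (proper_ge0 t).
exact: (rates_le polP j s0 pZ.1 (Logic.I : [set: R] t)).
Qed.

(** Waiting up to [rho] is already counted for all volume present then. On the window, the processed
    part [W] adds [m], the rest waits for [T - rho], and jobs arriving at [T] have not waited
    yet. *)
Lemma accrued_step rho T (W : 'rV[R]_n) m : rho < T -> quiet rho T ->
    (forall j, has_integral `[rho, T[%classic (fun t => Z t 0 j) (W 0 j)) ->
    has_integral `[rho, T[%classic (delay_cost d rho Z) m ->
  accrued T = accrued rho + m + (T - rho) * dot d (remaining I Z rho - W).
Proof.
move=> rT q hW hm.
have [mj hmj] := choice (proper_moment rho rho T).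
have -> : m = \sum_j d 0 j * mj j.
  apply: has_integral_unique hm _.
  have := has_integral_sum (measurable_itv _) (index_enum 'I_n)
    (fun j => has_integralZ (measurable_itv _) (d 0 j) (hmj j)).
  apply: eq_has_integral => // t _; rewrite /delay_cost /dot mulr_sumr.
  by apply: eq_bigr => j _; ring.
rewrite /dot mulr_sumr /accrued -!big_split; apply: eq_bigr => j _ /=.
have [jI|jI] := boolP (j \in jobs I); last first.
  by rewrite densityE (negbTE jI) !mul0r mulr0 !addr0.
have -> : (remaining I Z rho - W) 0 j = remaining I Z rho 0 j - W 0 j.
  by move: (remaining I Z rho) => x; rewrite !mxE.
rewrite [(T - rho) * _]mulrCA -!mulrDr; congr (_ * _).
have b2 : (BLeft rho <= BLeft T)%O by rewrite bnd_simp ltW.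
have [jr|Tj] := q j jI; last first.
  have nr : ~~ arrived I rho j.
    by rewrite /arrived jI/= -ltNge; exact: lt_le_trans Tj.
  rewrite (remaining_notin nr) (window_zero Tj (hW j)).
  have -> : mj j = 0.
    apply: has_integral_unique (hmj j) _.
    apply: eq_has_integral (has_integral0 _) => //.
    move=> t /in_itvco/andP[_ tT]; rewrite pZ.2 ?mulr0//; apply/negP => /andP[_].
    by rewrite leNgt (lt_le_trans tT Tj).
  rewrite set_itv_ge ?bnd_simp -?leNgt// set_itv_ge ?bnd_simp -?leNgt//; last first.
    exact: le_trans (ltW rT) Tj.
  rewrite !Rintegral_set0; have [jT|jT] := eqVneq (release I j) T.
    by rewrite jT; ring.
  by rewrite remaining_notin ?/arrived ?jI/= -?ltNge ?lt_neqAle 1?eq_sym ?jT//; ring.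
have b1 : (BLeft (release I j) <= BLeft rho)%O by rewrite bnd_simp.
have Tj : arrived I T j by rewrite /arrived jI (le_trans jr)// ltW.
have rj : arrived I rho j by rewrite /arrived jI.
have [c hc] := proper_window (release I j) rho j.
have [c1 h1] := proper_moment (release I j) (release I j) rho j.
have h2 : has_integral `[rho, T[%classic (fun t => (t - release I j) * Z t 0 j)
    (mj j + (rho - release I j) * W 0 j).
  apply: eq_has_integral (has_integralD _ (hmj j)
    (has_integralZ _ (rho - release I j) (hW j))) => // t _; ring.
have [_ ->] := has_integral_cat b1 b2 h1 h2.
have [_ ->] := h1.
rewrite (remainingE Tj (has_integral_cat b1 b2 hc (hW j))).
rewrite (remainingE rj hc).
by ring.
Qed.

End proper.
End instances.

(** * Fractional flow as waiting accrued plus the delay cost of the tail *)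

Section flow.
Context {R : realType} {n : nat} (P : set 'rV[R]_n).
Hypothesis polP : scheduling_polytope P.
Notation mu := (@lebesgue_measure R).
Variable I : instance R n.
Notation d := (density I).
Let d0 := density_ge0 I.
Implicit Types (Z : R -> 'rV[R]_n) (t rho T s : R) (j : 'I_n).

Lemma density_notin j : j \notin jobs I -> d 0 j = 0.
Proof. by rewrite densityE => /negbTE ->. Qed.

Lemma feasible_remaining_ge0 s Z rho : 0 <= s -> feasible P s I Z ->
  vle 0 (remaining I Z rho).
Proof.
move=> s0 fZ; have pZ := feasible_proper fZ; apply/vle0P => j.
have [rj|rj] := boolP (arrived I rho j); last by rewrite remaining_notin.
have /andP[jI jr] := rj; have [_ _ _ /(_ j jI) Zj] := fZ.
have Z0 t : 0 <= Z t 0 j by exact: vle_ge0 (proper_ge0 polP s0 pZ t).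
have mZ : measurable_fun `[release I j, +oo[%classic (fun t => Z t 0 j).
  exact: (proper_rates pZ (measurable_itv _)).1.
have hZ := ge0_has_integral mZ (fun t _ => Z0 t) Zj.
have b1 : (BLeft (release I j) <= BLeft rho)%O by rewrite bnd_simp.
have b2 : (BLeft rho <= +oo)%O by [].
have [a [b [ha hb sE]]] := has_integral_split b1 b2 hZ.
rewrite (remainingE rj ha) sE addrC addKr.
by apply: has_integral_ge0 hb _.
Qed.

Lemma flow_of_plan s Z rho c : 0 <= s -> proper_schedule P I s Z ->
    (forall j, j \in jobs I -> release I j <= rho) ->
    plan P d rho s (remaining I Z rho) c Z ->
  feasible P s I Z /\ fractional_flow I Z = (accrued I Z rho + c)%:E.
Proof.
move=> s0 pZ rmax [rZ Zx Zc].
have Z0 t : vle 0 (Z t) by exact: (proper_ge0 polP s0 pZ).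
have mrho := measurable_itv `[rho, +oo[.
have bnd j : j \in jobs I -> (BLeft (release I j) <= BLeft rho)%O.
  by move=> /rmax; rewrite bnd_simp.
split.
  split; [exact: pZ.1.1|by move=> t; exact: pZ.1.2|exact: pZ.2|].
  move=> j jI; have [a ha] := proper_window polP s0 pZ (release I j) rho j.
  have b2 : (BLeft rho <= +oo)%O by [].
  rewrite (has_integralE _ (has_integral_cat (bnd j jI) b2 ha (Zx j)))//.
  by rewrite (remainingE _ ha) ?/arrived ?jI ?rmax// addrC subrK.
(* The share of each job is integrable because it is dominated by the total delay cost, all shares
   being nonnegative. *)
have /choice[cj hcj] j : exists b, has_integral `[rho, +oo[%classic
    (fun t => d 0 j * ((t - rho) * Z t 0 j)) b.
  apply: (dominated_has_integral mrho _ Zc).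
    apply: measurable_funM => //; apply: measurable_funM (rZ.1 j).
    exact: measurable_funB.
  move=> t /in_itvcy rt.
  have ge0 i : 0 <= d 0 i * ((t - rho) * Z t 0 i).
    by apply: mulr_ge0; [exact: vle_ge0|apply: mulr_ge0; [lra|exact: vle_ge0]].
  rewrite ger0_norm// /delay_cost /dot mulr_sumr (bigD1 j)//= mulrCA lerDl.
  by apply: sumr_ge0 => i _; rewrite mulrCA.
have cE : c = \sum_j cj j.
  apply: has_integral_unique Zc _.
  have := has_integral_sum mrho (index_enum 'I_n) hcj.
  apply: eq_has_integral => // t _; rewrite /delay_cost /dot mulr_sumr.
  by apply: eq_bigr => j _; ring.
pose v j := d 0 j * (\int[mu]_(t in `[release I j, rho[) ((t - release I j) * Z t 0 j)
  + (rho - release I j) * remaining I Z rho 0 j) + cj j.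
have vE j : j \in jobs I -> has_integral `[release I j, +oo[%classic
    (fun t => weight I j / job_size I j * (t - release I j) * Z t 0 j) (v j).
  move=> jI; have b2 : (BLeft rho <= +oo)%O by [].
  have [m hm] := proper_moment polP s0 pZ (release I j) (release I j) rho j.
  have h2 : has_integral `[rho, +oo[%classic
      (fun t => d 0 j * ((t - release I j) * Z t 0 j))
      (cj j + d 0 j * (rho - release I j) * remaining I Z rho 0 j).
    apply: eq_has_integral (has_integralD mrho (hcj j)
      (has_integralZ mrho (d 0 j * (rho - release I j)) (Zx j))) => // t _.
    by ring.
  have -> : v j = d 0 j * m +
      (cj j + d 0 j * (rho - release I j) * remaining I Z rho 0 j).
    by rewrite /v hm.2; ring.
  have h1 := has_integralZ (measurable_itv _) (d 0 j) hm.
  apply: eq_has_integral (has_integral_cat (bnd j jI) b2 h1 h2) => // t _.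
  by rewrite densityE jI mulrA.
rewrite /fractional_flow (eq_bigr (fun j => (v j)%:E)); last first.
  by move=> j jI; exact: has_integralE (vE j jI).
rewrite sumEFin cE /accrued -big_split /=; congr EFin.
rewrite big_mkcond /=; apply: eq_bigr => j _; case: ifPn => // jI.
have -> : cj j = 0.
  apply: has_integral_unique (hcj j) _.
  apply: eq_has_integral (has_integral0 _) => // t _.
  by rewrite density_notin// mul0r.
by rewrite density_notin// mul0r addr0.
Qed.

(** Finite flow makes the delay cost of the tail integrable, so that a competitor can be superposed
    with gradient descent after the last arrival. *)
Lemma plan_of_flow s Z rho v : 0 <= s -> feasible P s I Z ->
    (forall j, j \in jobs I -> release I j <= rho) ->
    fractional_flow I Z = v%:E ->
  exists c, plan P d rho s (remaining I Z rho) c Z.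
Proof.
move=> s0 fZ rmax vE; have pZ := feasible_proper fZ.
have mrho := measurable_itv `[rho, +oo[.
have rZ := proper_rates pZ mrho.
have Z0 t j : 0 <= Z t 0 j by exact: vle_ge0 (proper_ge0 polP s0 pZ t).
have mZ (a : R) j : measurable_fun `[a, +oo[%classic (fun t => Z t 0 j).
  exact: (proper_rates pZ (measurable_itv _)).1.
have Zx j : has_integral `[rho, +oo[%classic (fun t => Z t 0 j) (remaining I Z rho 0 j).
  have [jI|jI] := boolP (j \in jobs I); last first.
    rewrite remaining_notin ?/arrived ?(negbTE jI)//.
    apply: eq_has_integral (has_integral0 _) => // t _.
    by rewrite pZ.2// /arrived (negbTE jI).
  have [_ _ _ /(_ j jI) Zj] := fZ.
  have hZ := ge0_has_integral (mZ _ _) (fun t _ => Z0 t j) Zj.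
  have b1 : (BLeft (release I j) <= BLeft rho)%O by rewrite bnd_simp rmax.
  have b2 : (BLeft rho <= +oo)%O by [].
  have [a [b [ha hb sE]]] := has_integral_split b1 b2 hZ.
  by rewrite (remainingE _ ha) ?/arrived ?jI ?rmax// sE addrC addKr.
have /choice[cj hcj] j : exists b, has_integral `[rho, +oo[%classic
    (fun t => d 0 j * ((t - rho) * Z t 0 j)) b.
  have [jI|jI] := boolP (j \in jobs I); last first.
    exists 0; apply: eq_has_integral (has_integral0 _) => // t _.
    by rewrite density_notin// mul0r.
  pose g t := weight I j / job_size I j * (t - release I j) * Z t 0 j.
  have wp0 : 0 <= weight I j / job_size I j.
    by rewrite divr_ge0 ?weight_ge0// ltW// job_size_gt0.
  have g0 k t : release I k <= t -> k \in jobs I ->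
      0 <= weight I k / job_size I k * (t - release I k) * Z t 0 k.
    move=> kt kI; rewrite mulr_ge0// mulr_ge0 ?subr_ge0//.
    by rewrite divr_ge0 ?weight_ge0// ltW// job_size_gt0.
  have gfin : (\int[mu]_(t in `[release I j, +oo[) (g t)%:E \is a fin_num)%E.
    rewrite ge0_fin_numE; last first.
      by apply: integral_ge0 => t /in_itvcy jt; rewrite lee_fin g0.
    apply: (@le_lt_trans _ _ v%:E); last exact: ltry.
    rewrite -vE /fractional_flow (bigD1 j)//= leeDl// sume_ge0// => k /andP[kI _].
    by apply: integral_ge0 => t /in_itvcy kt; rewrite lee_fin g0.
  have mg : measurable_fun `[release I j, +oo[%classic g.
    apply: measurable_funM => //; apply: measurable_funM => //.
    exact: measurable_funB.
  have hg : has_integral `[release I j, +oo[%classic g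
      (fine (\int[mu]_(t in `[release I j, +oo[) (g t)%:E)%E).
    apply: ge0_has_integral => //; last by rewrite fineK.
    by move=> t /in_itvcy jt; exact: g0.
  have b1 : (BLeft (release I j) <= BLeft rho)%O by rewrite bnd_simp rmax.
  have b2 : (BLeft rho <= +oo)%O by [].
  have [a [b [_ hb _]]] := has_integral_split b1 b2 hg.
  exists (b - d 0 j * (rho - release I j) * remaining I Z rho 0 j).
  apply: eq_has_integral (has_integralB mrho hb
    (has_integralZ mrho (d 0 j * (rho - release I j)) (Zx j))) => // t _.
  by rewrite /g densityE jI; ring.
exists (\sum_j cj j); split=> //.
have := has_integral_sum mrho (index_enum 'I_n) hcj.
apply: eq_has_integral => // t _; rewrite /delay_cost /dot mulr_sumr.
by apply: eq_bigr => j _; ring.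
Qed.

Lemma accrued_none Z rho : (forall j, ~~ arrived I rho j) -> accrued I Z rho = 0.
Proof.
move=> no; apply: big1 => j _; rewrite remaining_notin// mulr0 addr0.
have [jI|jI] := boolP (j \in jobs I); last by rewrite density_notin// mul0r.
have := no j; rewrite /arrived jI/= -ltNge => rj.
by rewrite set_itv_ge ?bnd_simp -?leNgt ?ltW// Rintegral_set0 mulr0.
Qed.

Lemma remaining_none Z rho : (forall j, ~~ arrived I rho j) -> remaining I Z rho = 0.
Proof. by move=> no; apply/rowP => j; rewrite remaining_notin// mxE. Qed.

Lemma piecewise_rates s Z :
    (forall t, (forall j, ~~ arrived I t j) -> Z t = 0) ->
    (forall rho, checkpoint I rho ->
      exists2 Y, rates P s `[rho, +oo[%classic Y &
        forall t, rho <= t -> (forall j, arrived I t j -> release I j <= rho) ->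
          Y t = Z t) ->
  rates P s [set: R] Z.
Proof.
move=> Z0 ZY.
have below T : rates P s `]-oo, T[%classic Z.
  move: T; apply: (@checkpoint_ind _ _ I) => [rho no|rho T rT crho q IH].
    apply: (@eq_rates _ _ _ _ _ (fun=> 0)) => [t /=|].
      rewrite in_itv/= => tr; rewrite Z0// => j; apply: contra (no j).
      by move=> /andP[jI jt]; rewrite /arrived jI (le_trans jt)// ltW.
    split=> [j|t _]; first exact: measurable_cst.
    by exists 0; rewrite ?scaler0//; exact: polytope0.
  have b1 : (-oo <= BLeft rho)%O by [].
  have b2 : (BLeft rho <= BLeft T)%O by rewrite bnd_simp ltW.
  apply: (rates_cat b1 b2 IH).
  have [Y rY YA] := ZY rho crho.
  have {}rY : rates P s `[rho, T[%classic Y.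
    apply: rates_subset rY => // t /in_itvco/andP[rt _]; exact/in_itvcy.
  apply: eq_rates rY => t /in_itvco/andP[rt tT]; apply: YA => // j.
  move=> /andP[/q[//|Tj] jt].
  by have := lt_le_trans tT (le_trans Tj jt); rewrite ltxx.
have [rho [crho rmax]] := final_checkpoint I.
rewrite -set_itvNyy.
have b1 : (-oo <= BLeft rho)%O by [].
have b2 : (BLeft rho <= +oo)%O by [].
apply: (rates_cat b1 b2 (below rho)).
have [Y rY YA] := ZY rho crho.
apply: eq_rates rY => t /in_itvcy rt; apply: YA => // j /andP[jI _].
exact: rmax.
Qed.

End flow.

(** * Gradient descent between checkpoints *)

Section gradient_descent.
Context {R : realType} {n : nat} (P : set 'rV[R]_n).
Hypotheses (polP : scheduling_polytope P) (attP : residual_attained P).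
Variable I : instance R n.
Notation d := (density I).
Let d0 := density_ge0 I.
Notation f := (residual_value P d).

(** Gradient descent comes with a minimizer at each release, so nonnegativity of the remaining sizes
    at that time can be read off from it. *)
Lemma residual_feasible_ge0 (x : 'rV[R]_n) z : residual_feasible P x z -> vle 0 x.
Proof.
move=> [_ zP _ zx]; apply/vle0P => j; rewrite -lee_fin -zx.
apply: integral_ge0 => t /in_itvcy t0; rewrite lee_fin.
exact: vle_ge0 (polytope_ge0 polP (zP _ t0)).
Qed.

Section speed.
Variables (s : R) (A : R -> 'rV[R]_n).
Hypotheses (s0 : 0 < s) (gdA : gradient_descent P s I A).

Lemma gd_checkpoint rho : checkpoint I rho ->
  exists2 z, residual_minimizer P d (remaining I A rho) z &
    forall t, rho <= t -> (forall j, arrived I t j -> release I j <= rho) ->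
      A t = s *: z (s * (t - rho)).
Proof.
have [A0 Ai] := gdA.
move=> [[i iI <-]|no].
  have [z zmin zA] := Ai i iI; exists z => // t it tq.
  have := zA (t - release I i); rewrite subrKC => -> //.
    by rewrite subr_ge0.
  by move=> j tj; rewrite /arrived tq// andbT; case/andP: tj.
have [z zmin] := attP d0 (vle_refl (0 : 'rV[R]_n)).
exists z; first by rewrite remaining_none.
move=> t rt tq; rewrite A0; last first.
  move=> j; apply/negP => tj; have := no j; rewrite /arrived tq// andbT.
  by case/andP: tj => ->.
apply/rowP => j; rewrite !mxE; have [[_ _ z0 _] _] := zmin.
by rewrite z0 ?mulr0 ?mxE// mulr_ge0 ?subr_ge0// ltW.
Qed.

Lemma gd_checkpoint_plan rho : checkpoint I rho ->
  exists Y, plan P d rho s (remaining I A rho) (f (remaining I A rho) / s) Y /\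
    forall t, rho <= t -> (forall j, arrived I t j -> release I j <= rho) ->
      Y t = A t.
Proof.
move=> /gd_checkpoint[z zmin zA]; have x0 := residual_feasible_ge0 zmin.1.
exists (fun t => s *: z (s * (t - rho))); split.
  exact: minimizer_speed_plan.
by move=> t rt tq; rewrite zA.
Qed.

Lemma gd_proper : proper_schedule P I s A.
Proof.
split.
  apply: piecewise_rates => //; first exact: gdA.1.
  by move=> rho /gd_checkpoint_plan[Y [[rY _ _] YA]]; exists Y.
move=> t j tj; have [rho [rt crho tq]] := last_checkpoint I t.
have [z [[_ _ z0 _] _] ->//] := gd_checkpoint crho.
rewrite mxE z0 ?mulr0//; last by rewrite mulr_ge0 ?subr_ge0// ltW.
apply: remaining_notin; apply: contra tj => /andP[jI jr].
by rewrite /arrived jI (le_trans jr).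
Qed.

End speed.
End gradient_descent.

(** * The potential function argument *)

Section potential.
Context {R : realType} {n : nat} (P : set 'rV[R]_n).
Hypotheses (polP : scheduling_polytope P) (attP : residual_attained P).
Hypothesis lsP : forall c, vle 0 c -> linear_substitute (rate_value P c).
Variable I : instance R n.
Notation d := (density I).
Let d0 := density_ge0 I.
Notation f := (residual_value P d).
Variables (eps : R) (A : R -> 'rV[R]_n).
Hypotheses (eps0 : 0 < eps) (gdA : gradient_descent P (1 + eps) I A).
Let s0 : 0 < 1 + eps. Proof. by rewrite addr_gt0. Qed.

(* The potential is [2 / eps * (f xA - f (xA + xO) / 2)], where [xA] and [xO]
   are the remaining sizes under the algorithm and under the competitor. The
   two copies of a job have equal density, so they may be merged in [xA + xO]. *)
Lemma potential_bound (O : R -> 'rV[R]_n) T : feasible P 1 I O ->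
  vle 0 (remaining I A T) /\
  eps * accrued I A T + 2 * f (remaining I A T)
    - f (remaining I A T + remaining I O T) <= (2 + eps) * accrued I O T.
Proof.
move=> fO; have pO := feasible_proper fO.
have pA := gd_proper polP attP s0 gdA.
move: T; apply: (@checkpoint_ind _ _ I) => [rho no|rho T rT crho q [xA0 IH]].
  rewrite !remaining_none// !accrued_none// addr0 residual_value0//.
  by split; [exact: vle_refl|lra].
have [Y [plY YA]] := gd_checkpoint_plan polP attP s0 gdA crho.
have {}YA t : `[rho, T[%classic t -> Y t = A t.
  move=> /in_itvco/andP[rt tT]; apply: YA => // j /andP[/q[//|Tj] jt].
  by have := lt_le_trans tT (le_trans Tj jt); rewrite ltxx.
have [W [m [x' [c' [hW hm plx' xE cE]]]]] := plan_split (ltW rT) (ltW s0) plY.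
have [x'0 c'0] := plan_ge0 polP d0 (ltW s0) plx'.
have hWA j : has_integral `[rho, T[%classic (fun t => A t 0 j) (W 0 j).
  by apply: eq_has_integral (hW j) => // t /YA ->.
have hmA : has_integral `[rho, T[%classic (delay_cost d rho A) m.
  by apply: eq_has_integral hm => // t Dt; rewrite /delay_cost YA.
have rO := proper_rates pO (measurable_itv `[rho, T[).
have rA := proper_rates pA (measurable_itv `[rho, T[).
have [V [k [hV hk]]] := window_integrals polP d0 ler01 rO.
have remA := remaining_step polP (ltW s0) pA rT q hWA.
have remO := remaining_step polP ler01 pO rT q hV.
have accA := accrued_step polP (ltW s0) pA rT q hWA hmA.
have accO := accrued_step polP ler01 pO rT q hV hk.
set e := arriving I T in remA remO.
have e0 : vle 0 e := arriving_ge0 I T.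
set xA := remaining I A rho in xA0 IH plY xE cE remA accA.
set xO := remaining I O rho in IH remO accO.
have xAW : xA - W = x' by rewrite xE addrC addKr.
pose y' := xO - V.
rewrite xAW in remA accA; rewrite -/y' in remO accO.
have new j : e 0 j != 0 -> xA 0 j = 0 /\ (W 0 j = 0 /\ (xO 0 j = 0 /\ V 0 j = 0)).
  rewrite mxE; case: ifP => [/andP[jI /eqP jT] _|_]; last by rewrite eqxx.
  have nr : ~~ arrived I rho j by rewrite /arrived jI/= -ltNge jT.
  have Tj : T <= release I j by rewrite jT.
  rewrite !remaining_notin//; split=> //; split; first exact: (window_zero pA Tj (hWA j)).
  by split=> //; exact: (window_zero pO Tj (hV j)).
have disj j : e 0 j = 0 \/ x' 0 j = 0 /\ y' 0 j = 0.
  have [ej|/new[h1 [h2 [h3 h4]]]] := eqVneq (e 0 j) 0; first by left.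
  by right; rewrite -xAW /y' !rowB h1 h2 h3 h4 subrr.
have y'0 : vle 0 y'.
  apply/vle0P => j; have [ej|[_ ->//]] := disj j.
  have := vle_ge0 j (feasible_remaining_ge0 polP T ler01 fO).
  by rewrite remO rowD ej addr0.
have xy'0 : vle 0 (x' + y') by exact: vleD0.
(* A plan for [xA + xO]: the superposed rates of [A] and [O] up to [T], then an optimal continuation
   from [x' + y'] at their joint speed. Its cost limits how fast [f] of the sum can fall. *)
have [Y' plY'] := residual_value_plan polP d0 attP T xy'0 (addr_gt0 s0 ltr01).
have rAO := rates_add polP s0 ltr01 rA rO.
have hAO j : has_integral `[rho, T[%classic (fun t => (A t + O t) 0 j) ((W + V) 0 j).
  rewrite mxE; apply: eq_has_integral (has_integralD _ (hWA j) (hV j)) => // t _.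
  by rewrite mxE.
have hmk : has_integral `[rho, T[%classic (delay_cost d rho (fun t => A t + O t)) (m + k).
  apply: eq_has_integral (has_integralD _ hmA hk) => // t _.
  by rewrite /delay_cost dotDr mulrDr.
have := plan_cat (ltW rT) rAO hAO hmk plY'.
have -> : W + V + (x' + y') = xA + xO.
  by rewrite -xAW addrACA !subrKC.
have xO0 : vle 0 xO := feasible_remaining_ge0 polP rho ler01 fO.
have s10 : 0 < 1 + eps + 1 by rewrite addr_gt0.
move=> /(residual_value_le polP d0 s10 (vleD0 xA0 xO0) (vle_refl _)).
(* What is left of the minimizer at [T] is a plan for [x'], so [f] falls along [A] by at least
   [(1 + eps) * (m + (T - rho) * dot d x')]. *)
have fx' := residual_value_le polP d0 s0 x'0 (vle_refl _) plx'.
have := residual_value_arrival polP d0 attP lsP x'0 y'0 e0 disj.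
have fxA : f xA = (1 + eps) * (m + (T - rho) * dot d x' + c').
  by rewrite -cE mulrC divfK// gt_eqF.
rewrite remA remO accA accO.
have -> : x' + e + (y' + e) = x' + y' + 2 *: e.
  by rewrite addrACA scaler_nat mulr2n.
move=> arr comb; split; first exact: vleD0.
have comb' : f (xA + xO) <= (2 + eps) * (m + k + (T - rho) * (dot d x' + dot d y'))
    + f (x' + y').
  apply: le_trans comb _; rewrite dotDr mulrDr [X in _ + X]mulrC divfK ?gt_eqF//.
  by rewrite lerD2r; lra.
rewrite fxA in IH.
move: (f (xA + xO)) (f (x' + y')) (f (x' + y' + 2 *: e)) (f (x' + e)) (f x')
  IH fx' arr comb' => F1 F2 F3 F4 F5.
move: (dot d x') (dot d y') (accrued I A rho) (accrued I O rho) => p r aA aO.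
(* The contributions of [A], namely [m + L * p], cancel because [eps + (2 + eps) = 2 * (1 + eps)];
   only those of [O] remain. *)
move: (T - rho) => L; nra.
Qed.

Lemma gd_feasible : feasible P (1 + eps) I A /\
  exists rho, (forall j, j \in jobs I -> release I j <= rho) /\
    fractional_flow I A =
      (accrued I A rho + f (remaining I A rho) / (1 + eps))%:E.
Proof.
have [rho [crho rmax]] := final_checkpoint I.
have pA := gd_proper polP attP s0 gdA.
have [Y [[rY Yx Yc] YA]] := gd_checkpoint_plan polP attP s0 gdA crho.
have {}YA t : `[rho, +oo[%classic t -> Y t = A t.
  by move=> /in_itvcy rt; apply: YA => // j /andP[/rmax].
have plA : plan P d rho (1 + eps) (remaining I A rho)
    (f (remaining I A rho) / (1 + eps)) A.
  split; first exact: eq_rates rY.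
    by move=> j; apply: eq_has_integral (Yx j) => // t /YA ->.
  by apply: eq_has_integral Yc => // t Dt; rewrite /delay_cost YA.
have [fA flowA] := flow_of_plan polP (ltW s0) pA rmax plA.
by split=> //; exists rho.
Qed.

Lemma gd_fractional_flow (O : R -> 'rV[R]_n) : feasible P 1 I O ->
  (fractional_flow I A <= ((2 + eps) / eps)%:E * fractional_flow I O)%E.
Proof.
move=> fO; have pO := feasible_proper fO.
have [fA [rho [rmax flowA]]] := gd_feasible.
have K0 : 0 < (2 + eps) / eps by rewrite divr_gt0// addr_gt0.
have flow0 : (0 <= fractional_flow I O)%E.
  apply: sume_ge0 => j jI; apply: integral_ge0 => t /in_itvcy jt.
  rewrite lee_fin mulr_ge0//; last exact: vle_ge0 (proper_ge0 polP ler01 pO t).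
  by rewrite mulr_ge0 ?subr_ge0// divr_ge0 ?weight_ge0// ltW// job_size_gt0.
have [flowO|] := boolP (fractional_flow I O \is a fin_num); last first.
  rewrite ge0_fin_numE// -leNgt leye_eq => /eqP ->.
  by rewrite gt0_muley ?lte_fin// leey.
have [c plO] := plan_of_flow polP ler01 fO rmax (esym (fineK flowO)).
have [_ ->] := flow_of_plan polP ler01 pO rmax plO.
rewrite flowA -EFinM lee_fin.
have [xA0 pot] := potential_bound rho fO.
set xA := remaining I A rho in xA0 pot plO flowA *.
set xO := remaining I O rho in pot plO *.
have [z zmin] := attP d0 xA0.
have plA := minimizer_speed_plan polP d0 rho xA0 s0 zmin.
have s10 : 0 < 1 + eps + 1 by rewrite addr_gt0.
have [xO0 _] := plan_ge0 polP d0 ler01 plO.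
(* After the last arrival both schedules run to completion, so the superposition covers the whole
   tail and bounds [f (xA + xO)] directly. *)
have := residual_value_le polP d0 s10 (vleD0 xA0 xO0) (vle_refl _)
  (plan_add polP s0 ltr01 plA plO).
have sE : f xA = (1 + eps) * (f xA / (1 + eps)) by rewrite mulrC divfK// gt_eqF.
move: pot; rewrite {1}sE; move: (f xA / (1 + eps)) => g pot comb.
rewrite mulrAC ler_pdivlMr//.
move: (f (xA + xO)) (accrued I A rho) (accrued I O rho) pot comb => F aA aO.
nra.
Qed.

End potential.

(** * Existence of an online gradient descent *)

Section construction.
Context {R : realType} {n : nat} (P : set 'rV[R]_n).
Hypotheses (polP : scheduling_polytope P) (attP : residual_attained P).
Variable s : R.
Hypothesis s0 : 0 < s.
Implicit Types (I : instance R n) (t rho : R) (j : 'I_n) (k : nat).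

(* Unlike [density], this does not look at the jobs of the future. *)
Definition arrived_density I t : 'rV[R]_n :=
  \row_j (if arrived I t j then weight I j / job_size I j else 0).

Definition last_arrival I t : option 'I_n :=
  [pick i | arrived I t i &&
     [forall j, arrived I t j ==> (release I j <= release I i)]].

(** A fixed choice depending only on [d] and [x], which makes the run a function of the data
    revealed so far. The default 0 is an admissible rate function. *)
Definition minimizer (d x : 'rV[R]_n) : R -> 'rV[R]_n :=
  xget (fun=> 0) [set z | residual_minimizer P d x z].

(* [k] is fuel: the value at [t] is the intended one once [k] is at least the
   number of jobs that have arrived by [t]. *)
Fixpoint gd_iter k I : schedule R n := fun t =>
  if k is k'.+1 then
    if last_arrival I t is Some i then
      s *: minimizer (arrived_density I (release I i))
             (remaining I (gd_iter k' I) (release I i)) (s * (t - release I i))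
    else 0
  else 0.

Lemma last_arrivalP I t :
  if last_arrival I t is Some i
  then arrived I t i /\ forall j, arrived I t j -> release I j <= release I i
  else forall j, ~~ arrived I t j.
Proof.
rewrite /last_arrival; case: pickP => [i /andP[ti /forallP H]|H j].
  by split=> // j tj; have := H j; rewrite tj.
apply/negP => tj.
have [m mt mmax] := @arg_maxP _ _ _ j (arrived I t) (release I) tj.
have := H m; rewrite mt/= => /negP; apply; apply/forallP => i.
by apply/implyP => /mmax.
Qed.

Lemma agree_upto_le t u I I' : u <= t -> agree_upto t I I' -> agree_upto u I I'.
Proof.
move=> ut ag j; have [tt tH] := ag j.
have up (J : instance R n) : arrived J u j -> arrived J t j.
  by move=> /andP[jI ju]; rewrite /arrived jI (le_trans ju).
have uu : arrived I u j = arrived I' u j.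
  apply/idP/idP => uj; have tj := up _ uj.
    have [rE _ _] := tH tj; move: tj; rewrite tt => /andP[jI' _].
    by rewrite /arrived jI'/= -rE; case/andP: uj.
  rewrite -tt in tj; have [rE _ _] := tH tj; case/andP: tj => jI _.
  by rewrite /arrived jI/= rE; case/andP: uj.
by split=> // uj; apply: tH; exact: up.
Qed.

Lemma gd_iter_online k : online (gd_iter k).
Proof.
elim: k => [//|k IH] t I I' ag /=.
have -> : last_arrival I' t = last_arrival I t.
  apply: eq_pick => i; have [ti tH] := ag i; rewrite -ti.
  have [it|//] := boolP (arrived I t i); rewrite /=.
  have [-> _ _] := tH it; apply: eq_forallb => j; have [tj tHj] := ag j.
  by rewrite -tj; have [jt|//] := boolP (arrived I t j); have [-> _ _] := tHj jt.
have := last_arrivalP I t; case: last_arrival => [i [ti _]|//].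
have [rE _ _] := (ag i).2 ti; rewrite -rE; set rho := release I i.
have rt : rho <= t by case/andP: ti.
have agr := agree_upto_le rt ag.
have -> : arrived_density I' rho = arrived_density I rho.
  apply/rowP => j; rewrite !mxE; have [<- H] := agr j.
  by case: ifP => // /H[_ -> ->].
suff -> : remaining I' (gd_iter k I') rho = remaining I (gd_iter k I) rho by [].
apply/esym/rowP => j; rewrite !mxE; have [<- H] := agr j.
case: ifP => // /H[-> -> _]; congr (_ - _); apply: eq_Rintegral => u.
rewrite inE/= in_itv/= => /andP[_ ur].
by rewrite (IH u I I')//; exact: agree_upto_le agr.
Qed.

(** Thanks to the default this holds for every [x], hence before the remaining sizes are known to be
    nonnegative. *)
Lemma minimizer_rates d x : rates P 1 `[0, +oo[%classic (minimizer d x).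
Proof.
apply/rates1P; have [[z zmin]|no] := pselect (exists z, residual_minimizer P d x z).
  have [[mz zP _ _] _] := xgetPex (fun=> 0) (ex_intro (residual_minimizer P d x) z zmin).
  by split=> // t /in_itvcy; exact: zP.
rewrite /minimizer xgetPN; last by move=> z zmin; apply: no; exists z.
by split=> [j|t _]; [exact: measurable_cst|exact: polytope0].
Qed.

Lemma minimizer0 (d x : 'rV[R]_n) j t : x 0 j = 0 -> 0 <= t -> minimizer d x t 0 j = 0.
Proof.
move=> xj t0.
have [[z zmin]|no] := pselect (exists z, residual_minimizer P d x z).
  have [[_ _ z0 _] _] := xgetPex (fun=> 0) (ex_intro (residual_minimizer P d x) z zmin).
  exact: z0.
by rewrite /minimizer xgetPN ?mxE// => z zmin; apply: no; exists z.
Qed.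

Lemma rates_speed rho (z : R -> 'rV[R]_n) : rates P 1 `[0, +oo[%classic z ->
  rates P s `[rho, +oo[%classic (fun t => s *: z (s * (t - rho))).
Proof.
move=> /rates1P[mz zP]; split=> [j|t /in_itvcy rt].
  have := measurable_funM (measurable_cst s)
    (measurable_fun_affine_itv (b := rho) s0 (mz j)).
  by apply: eq_measurable_fun => t _; rewrite /= add0r mxE.
exists (z (s * (t - rho))) => //; apply: zP; apply/in_itvcy.
by rewrite mulr_ge0 ?subr_ge0// ltW.
Qed.

Section fixed_instance.
Variable I : instance R n.

Lemma gd_iter0 k t : (forall j, ~~ arrived I t j) -> gd_iter k I t = 0.
Proof.
case: k => // k no /=; have := last_arrivalP I t.
by case: last_arrival => // i [ti _]; have := no i; rewrite ti.
Qed.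

Lemma gd_iterS k i t : i \in jobs I -> release I i <= t ->
    (forall j, arrived I t j -> release I j <= release I i) ->
  gd_iter k.+1 I t = s *: minimizer (arrived_density I (release I i))
    (remaining I (gd_iter k I) (release I i)) (s * (t - release I i)).
Proof.
move=> iI it tq /=; have := last_arrivalP I t; case: last_arrival; last first.
  by move=> /(_ i); rewrite /arrived iI it.
move=> i' [ti' tmax]; suff -> : release I i' = release I i by [].
by apply/eqP; rewrite eq_le tq// tmax// /arrived iI.
Qed.

Lemma gd_iter_rates k : rates P s [set: R] (gd_iter k I).
Proof.
case: k => [|k].
  split=> [j|t _]; first exact: measurable_cst.
  by exists 0; rewrite ?scaler0//; exact: polytope0.
apply: piecewise_rates => //; first by move=> t; exact: gd_iter0.
move=> rho [[i iI <-]|no].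
  exists (fun t => s *: minimizer (arrived_density I (release I i))
    (remaining I (gd_iter k I) (release I i)) (s * (t - release I i))).
    exact: rates_speed (minimizer_rates _ _).
  by move=> t it tq; rewrite (gd_iterS _ iI it tq).
exists (fun=> 0).
  split=> [j|t _]; first exact: measurable_cst.
  by exists 0; rewrite ?scaler0//; exact: polytope0.
move=> t rt tq; rewrite gd_iter0// => j; apply/negP => tj; have := no j.
by rewrite /arrived tq// andbT; case/andP: tj => ->.
Qed.

(** Agreement strictly before [rho] suffices, because the rate at the single time [rho] does not
    change the integral. *)
Lemma eq_remaining (Z Z' : R -> 'rV[R]_n) rho :
    rates P s [set: R] Z -> rates P s [set: R] Z' ->
    (forall t, t < rho -> Z t = Z' t) ->
  remaining I Z rho = remaining I Z' rho.
Proof.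
move=> rZ rZ' ZZ'; apply/rowP => j.
have [rj|rj] := boolP (arrived I rho j); last by rewrite !remaining_notin.
have mD := measurable_itv `[release I j, rho[.
have D := density_ge0 I.
have [X [_ [hX _]]] := window_integrals polP D (ltW s0)
  (rates_subset measurableT (fun _ _ => Logic.I) rZ : rates P s `[release I j, rho[ Z).
rewrite (remainingE rj (hX j)) (remainingE (Z := Z') (c := X 0 j) rj)//.
by apply: eq_has_integral (hX j) => // t /in_itvco/andP[_ /ZZ' ->].
Qed.

Lemma card_arrived_lt t u i : i \in jobs I -> release I i <= t -> u < release I i ->
  (#|arrived I u| < #|arrived I t|)%N.
Proof.
move=> iI it ui; apply: proper_card; apply/properP; split.
  apply/fintype.subsetP => j; rewrite !unfold_in => /andP[jI ju].
  by rewrite /arrived jI (le_trans ju)// (le_trans (ltW ui)).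
exists i; rewrite unfold_in /arrived iI//=.
by rewrite -ltNge.
Qed.

(** The value at [t] depends on the run strictly before the last arrival, when fewer jobs were
    present; one unit of fuel per arrived job is therefore enough. *)
Lemma gd_iter_stable k k' t : (#|arrived I t| <= k)%N -> (#|arrived I t| <= k')%N ->
  gd_iter k I t = gd_iter k' I t.
Proof.
elim: k k' t => [|k IH] k' t tk tk'.
  have no j : ~~ arrived I t j.
    apply/negP => tj; move: tk; rewrite leqNgt => /negP; apply.
    by apply/card_gt0P; exists j.
  by rewrite !gd_iter0.
have [[i ti]|no] := pselect (exists i, arrived I t i); last first.
  have no' j : ~~ arrived I t j by apply/negP => tj; apply: no; exists j.
  by rewrite !gd_iter0.
have t1 : (0 < #|arrived I t|)%N by apply/card_gt0P; exists i.
case: k' tk' => [|k'] tk'; first by rewrite leqNgt t1 in tk'.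
rewrite /=; have := last_arrivalP I t; case: last_arrival => [m [/andP[mI mt] _]|//].
suff -> : remaining I (gd_iter k I) (release I m) =
  remaining I (gd_iter k' I) (release I m) by [].
apply: eq_remaining; try exact: gd_iter_rates.
move=> u um; have := card_arrived_lt mI mt um => ut.
by apply: IH; rewrite -ltnS; exact: leq_trans ut _.
Qed.

(** Jobs with nothing left get rate 0, so their densities do not affect the cost. This reconciles
    [arrived_density], used by the online run, with [density]. *)
Lemma residual_minimizer_density (d1 d2 x : 'rV[R]_n) z :
    (forall j, x 0 j != 0 -> d1 0 j = d2 0 j) ->
  residual_minimizer P d1 x z -> residual_minimizer P d2 x z.
Proof.
move=> d12; have costE z' : residual_feasible P x z' ->
    residual_cost d1 z' = residual_cost d2 z'.
  move=> [_ _ z0 _]; apply: eq_bigr => j _.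
  have [xj|/d12 ->//] := eqVneq (x 0 j) 0.
  rewrite integral0_eq ?mule0// => t /in_itvcy t0.
  by rewrite z0// mulr0.
move=> [fz zE]; split=> //; rewrite -costE// zE; congr ereal_inf.
by apply/seteqP; split=> _ [z' fz' <-]; exists z'; rewrite ?costE.
Qed.

Definition gd_run : schedule R n := gd_iter n I.

Lemma gd_runE i t : i \in jobs I -> release I i <= t ->
    (forall j, arrived I t j -> release I j <= release I i) ->
  gd_run t = s *: minimizer (arrived_density I (release I i))
    (remaining I gd_run (release I i)) (s * (t - release I i)).
Proof.
move=> iI it tq; have n0 : (0 < n)%N by apply: leq_ltn_trans (ltn_ord i).
have -> : gd_run t = gd_iter n.-1.+1 I t by rewrite (prednK n0).
rewrite (gd_iterS _ iI it tq).
suff -> : remaining I (gd_iter n.-1 I) (release I i) =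
  remaining I gd_run (release I i) by [].
apply: eq_remaining; try exact: gd_iter_rates.
(* Job [i] has not arrived at [u], so at most [n.-1] jobs have, and the smaller amount of fuel
   suffices. *)
move=> u ui; have lt1 := card_arrived_lt iI (lexx _) ui.
have lt2 : (#|arrived I (release I i)| <= n)%N.
  by rewrite -[n in leqRHS]card_ord max_card.
apply: gd_iter_stable; last exact: leq_trans (ltnW lt1) lt2.
by rewrite -ltnS prednK//; exact: leq_trans lt1 lt2.
Qed.

Lemma gd_run_checkpoint rho : checkpoint I rho ->
  forall t, rho <= t -> (forall j, arrived I t j -> release I j <= rho) ->
    gd_run t = s *: minimizer (arrived_density I rho) (remaining I gd_run rho)
      (s * (t - rho)).
Proof.
move=> [[i iI <-] t it tq|no t rt tq]; first exact: gd_runE.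
have no' j : ~~ arrived I t j.
  apply/negP => tj; have := no j; rewrite /arrived tq// andbT.
  by case/andP: tj => ->.
rewrite /gd_run gd_iter0//; apply/rowP => j; rewrite !mxE minimizer0 ?mulr0//.
  by rewrite remaining_notin.
by rewrite mulr_ge0 ?subr_ge0// ltW.
Qed.

Lemma gd_run_proper : proper_schedule P I s gd_run.
Proof.
split=> [|t j tj]; first exact: gd_iter_rates.
have [rho [rt crho tq]] := last_checkpoint I t.
rewrite (gd_run_checkpoint crho rt tq) mxE minimizer0 ?mulr0//.
  apply: remaining_notin; apply: contra tj => /andP[jI jr].
  by rewrite /arrived jI (le_trans jr).
by rewrite mulr_ge0 ?subr_ge0// ltW.
Qed.

Lemma arrived_density_ge0 t : vle 0 (arrived_density I t).
Proof.
apply/vle0P => j; rewrite mxE; case: ifP => // /andP[jI _].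
by rewrite divr_ge0 ?weight_ge0// ltW// job_size_gt0.
Qed.

Lemma minimizerP (d x : 'rV[R]_n) : vle 0 d -> vle 0 x ->
  residual_minimizer P d x (minimizer d x).
Proof.
move=> d0 x0; have [z zmin] := attP d0 x0.
have := xgetPex (fun=> 0) (ex_intro (residual_minimizer P d x) z zmin); exact.
Qed.

(** Minimizers are known to exist only at nonnegative sizes, and following one up to the next
    arrival preserves nonnegativity. *)
Lemma gd_run_remaining_ge0 T : vle 0 (remaining I gd_run T).
Proof.
move: T; apply: (@checkpoint_ind _ _ I) => [rho no|rho T rT crho q x0].
  by rewrite remaining_none//; exact: vle_refl.
have dd0 := arrived_density_ge0 rho.
have plY := minimizer_speed_plan polP dd0 rho x0 s0 (minimizerP dd0 x0).
have [W [m [x' [c' [hW _ plx' xE _]]]]] := plan_split (ltW rT) (ltW s0) plY.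
have [x'0 _] := plan_ge0 polP dd0 (ltW s0) plx'.
have hWA j : has_integral `[rho, T[%classic (fun t => gd_run t 0 j) (W 0 j).
  apply: eq_has_integral (hW j) => // t /in_itvco/andP[rt tT].
  rewrite (gd_run_checkpoint crho rt)// => i /andP[/q[//|Ti] it].
  by have := lt_le_trans tT (le_trans Ti it); rewrite ltxx.
rewrite (remaining_step polP (ltW s0) gd_run_proper rT q hWA) {1}xE addrC.
rewrite [W + x']addrC addrK; apply: vleD0 => //; exact: arriving_ge0.
Qed.

Lemma gd_run_gradient_descent : gradient_descent P s I gd_run.
Proof.
split=> [t|i iI]; first exact: gd_iter0.
set rho := release I i; have x0 := gd_run_remaining_ge0 rho.
exists (minimizer (arrived_density I rho) (remaining I gd_run rho)).
  apply: residual_minimizer_density (minimizerP (arrived_density_ge0 rho) x0) => j.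
  move=> xj; rewrite densityE mxE; case: ifPn => [/andP[-> //]|/remaining_notin xj0].
  by rewrite xj0 eqxx in xj.
move=> tau tau0 tq; rewrite (@gd_runE i) ?lerDl//; last first.
  by move=> j /tq/andP[].
by rewrite addrC addKr.
Qed.

End fixed_instance.
End construction.

(** * Integral flow time *)

Section integral_versus_fractional.
Context {R : realType} {n : nat} (P : set 'rV[R]_n).
Hypothesis polP : scheduling_polytope P.
Notation mu := (@lebesgue_measure R).
Implicit Types (I : instance R n) (t s : R) (j : 'I_n).

(** A nonnegative [g] with integral 0 vanishes almost everywhere, and so does its product with [h],
    even for unbounded [h]. *)
Lemma has_integral_null_mul (D : set R) (g h : R -> R) : measurable D ->
    has_integral D g 0 -> (forall t, D t -> 0 <= g t) ->
    measurable_fun D h -> (forall t, D t -> 0 <= h t) ->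
  has_integral D (fun t => h t * g t) 0.
Proof.
move=> mD hg g0 mh h0; have mg := has_integral_measurable hg.
have mhg : measurable_fun D (fun t => h t * g t) by exact: measurable_funM.
have hg0 t : D t -> 0 <= h t * g t by move=> Dt; rewrite mulr_ge0 ?h0 ?g0.
have ae0 : ae_eq mu D (EFin \o g) (cst 0%E).
  apply/(ae_eq_integral_abs mu mD); first exact/measurable_EFinP.
  apply: etrans (has_integralE mD hg); apply: eq_integral => t; rewrite inE => Dt.
  by rewrite /= ger0_norm ?g0.
apply: ge0_has_integral => //.
pose k t : R := h t * g t.
have -> : (\int[mu]_(t in D) (h t * g t)%:E =
    \int[mu]_(t in D) `|(EFin \o k) t|)%E.
  by apply: eq_integral => t; rewrite inE => Dt; rewrite /= ger0_norm ?hg0.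
apply/(ae_eq_integral_abs mu mD); first exact/measurable_EFinP.
apply: filterS ae0 => t /= gt0 Dt; rewrite /k; have [->] := gt0 Dt.
by rewrite mulr0.
Qed.

Lemma release_le_completion I Z j : ((release I j)%:E <= completion_time I Z j)%E.
Proof. by apply: le_ereal_inf_tmp => _ [t [rt _] <-]; rewrite lee_fin. Qed.

(** The fractional flow of a job is its weight times the average wait of its volume, which is at
    most the wait until completion. *)
Lemma fractional_le_integral s I Z : 0 <= s -> feasible P s I Z ->
  (fractional_flow I Z <= integral_flow I Z)%E.
Proof.
move=> s0 fZ; have pZ := feasible_proper fZ.
apply: lee_sum => j jI; have [_ _ _ /(_ j jI) Zj] := fZ.
set r := release I j; set p := job_size I j; set w := weight I j.
have p0 : 0 < p by exact: job_size_gt0.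
have w0 : 0 <= w by exact: weight_ge0.
have Z0 t : 0 <= Z t 0 j by exact: vle_ge0 (proper_ge0 polP s0 pZ t).
have mZ (D : set R) : measurable D -> measurable_fun D (fun t => Z t 0 j).
  by move=> mD; exact: (proper_rates pZ mD).1.
have hZ := ge0_has_integral (mZ _ (measurable_itv `[r, +oo[)) (fun t _ => Z0 t) Zj.
(* After any time at which the job may be considered complete it is processed
   only on a null set. *)
have bound t' : r <= t' -> (\int[mu]_(t in `[r, t']) (Z t 0 j)%:E = p%:E)%E ->
    (\int[mu]_(t in `[r, +oo[) (w / p * (t - r) * Z t 0%R j)%:E <= (w * (t' - r))%:E)%E.
  move=> rt' Zt'; have b1 : (BLeft r <= BRight t')%O by rewrite bnd_simp.
  have b2 : (BRight t' <= +oo)%O by [].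
  have [a [b [ha hb pE]]] := has_integral_split b1 b2 hZ.
  have ap : a = p.
    have := has_integralE (measurable_itv _) ha; rewrite Zt' => -[].
    by [].
  have b0 : b = 0 by move: pE; rewrite ap -/p; lra.
  rewrite b0 in hb; rewrite ap in ha.
  have h1 := has_integral_cat b1 b2 (has_integralZ (measurable_itv _) (w / p * (t' - r)) ha)
    (has_integralZ (measurable_itv _) (w / p * (t' - r)) hb).
  have mh (D : set R) : measurable_fun D (fun t => w / p * (t - r)).
    apply: measurable_funM => //; apply: measurable_funTS.
    exact: measurable_funB.
  have wp0 : 0 <= w / p by rewrite divr_ge0// ltW.
  have rt (t : R) : t' < t -> r <= t by move=> t't; apply: le_trans rt' (ltW t't).
  have h2 : has_integral [set` Interval (BRight t') +oo%O]
      (fun t => w / p * (t - r) * Z t 0 j) 0.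
    apply: has_integral_null_mul => // t /=; rewrite in_itv/= andbT => t't.
    by rewrite mulr_ge0// subr_ge0 rt.
  have [c hc] : exists c, has_integral `[r, t']%classic
      (fun t => w / p * (t - r) * Z t 0 j) c.
    apply: (dominated_has_integral _ _ (has_integralZ (measurable_itv _) (w / p * (t' - r)) ha)) => //.
      by apply: measurable_funM; [exact: mh|exact: mZ].
    move=> t /=; rewrite in_itv/= => /andP[rt1 tt'].
    rewrite ger0_norm; last by rewrite mulr_ge0// mulr_ge0// subr_ge0.
    by rewrite ler_wpM2r// ler_wpM2l// lerD2r.
  have cle : c <= w / p * (t' - r) * p.
    apply: (le_has_integral (measurable_itv _) hc
      (has_integralZ (measurable_itv _) (w / p * (t' - r)) ha)) => t /=.
    rewrite in_itv/= => /andP[rt1 tt'].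
    by rewrite ler_wpM2r// ler_wpM2l// lerD2r.
  rewrite (has_integralE _ (has_integral_cat b1 b2 hc h2))// lee_fin addr0.
  apply: le_trans cle _; suff -> : w / p * (t' - r) * p = w * (t' - r) by [].
  by field; rewrite gt_eqF.
set X := (\int[mu]_(t in _) _)%E in bound *.
have rC := release_le_completion I Z j; rewrite -/r in rC *.
(* Weight 0 is split off: the completion time may then be infinite at no cost, and below the slack
   [eta / w] is used. *)
have [wz|wn0] := eqVneq w 0.
  rewrite wz mul0e /X integral0_eq// => t _.
  by rewrite wz !mul0r.
have wp : 0 < w by rewrite lt_neqAle eq_sym wn0.
have [Cy|Cfin] := eqVneq (completion_time I Z j) +oo%E.
  by rewrite Cy addye// gt0_muley ?lte_fin// leey.
have Cnum : completion_time I Z j \is a fin_num.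
  rewrite fin_numE Cfin andbT; apply/eqP => CNy; move: rC.
  by rewrite CNy leeNy_eq.
apply/lee_addgt0Pr => eta eta0.
have etaw : 0 < eta / w by rewrite divr_gt0.
have [_ [t' [rt' Zt'] <-] t'C] := lb_ereal_inf_adherent etaw Cnum.
apply: (le_trans (bound t' rt' Zt')).
move: t'C; rewrite -/(completion_time I Z j) -(fineK Cnum).
move: (fine (completion_time I Z j)) => c.
rewrite -EFinB -EFinM -!EFinD lte_fin lee_fin => t'c.
have : w * t' <= w * (c + eta / w) by rewrite ler_pM2l// ltW.
rewrite mulrDr mulrCA divff// mulr1; lra.
Qed.

(** The crossing time is the supremum of the times with [F t < v]. The equivalence turns a stopping
    rule on processed volume into a threshold in time. *)
Lemma lipschitz_crossing (F : R -> R) (a T v M : R) : a <= T -> 0 < M ->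
    (forall t u, a <= t -> t <= u -> F t <= F u <= F t + M * (u - t)) ->
    F a < v -> v <= F T ->
  exists2 t0, a <= t0 & F t0 = v /\ forall t, a <= t -> (t < t0) = (F t < v).
Proof.
move=> aT M0 FL Fav vFT.
have Fmono t u : a <= t -> t <= u -> F t <= F u by move=> h1 /(FL _ _ h1)/andP[].
have FLip t u : a <= t -> t <= u -> F u <= F t + M * (u - t).
  by move=> h1 /(FL _ _ h1)/andP[].
pose S := [set t | a <= t /\ F t < v].
have Sa : S a by split.
have ubS : ubound S T.
  move=> t [at' Ftv]; rewrite leNgt; apply/negP => Tt.
  by have := Fmono T t aT (ltW Tt); lra.
have hS : has_sup S by split; [exists a|exists T].
pose t0 := sup S.
have at0 : a <= t0 by apply: ub_le_sup => //; exists T.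
have Fle : F t0 <= v.
  rewrite leNgt; apply/negP => vF.
  have e0 : 0 < (F t0 - v) / M by rewrite divr_gt0// subr_gt0.
  have [t [at' Ftv] tt0] := sup_adherent e0 hS.
  have t0t : t <= t0 by apply: ub_le_sup; [exists T|split].
  have := FLip t t0 at' t0t.
  have : M * (t0 - t) <= F t0 - v.
    by rewrite mulrC -ler_pdivlMr//; move: tt0; rewrite -/t0; lra.
  by lra.
have Fge : v <= F t0.
  rewrite leNgt; apply/negP => Fv.
  have e0 : 0 < (v - F t0) / (2 * M) by rewrite divr_gt0 ?subr_gt0// mulr_gt0.
  pose t := t0 + (v - F t0) / (2 * M).
  have t0t : t0 <= t by rewrite lerDl ltW.
  have := FLip t0 t at0 t0t.
  have -> : M * (t - t0) = (v - F t0) / 2.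
    by rewrite /t; field; rewrite gt_eqF.
  move=> Ft; have St : S t by split; [exact: le_trans t0t|lra].
  have : t <= t0 by apply: ub_le_sup => //; exists T.
  by rewrite /t; lra.
have Ft0 : F t0 = v by apply/eqP; rewrite eq_le Fle.
exists t0 => //; split=> // t at'; apply/idP/idP => [tt0|Ftv].
  have e0 : 0 < t0 - t by rewrite subr_gt0.
  have [u [au Fuv]] := sup_adherent e0 hS; rewrite -/t0 subKr => tu.
  exact: le_lt_trans (Fmono _ _ at' (ltW tu)) Fuv.
by rewrite ltNge; apply/negP => t0t; have := Fmono _ _ at0 t0t; lra.
Qed.

End integral_versus_fractional.

(** * Speeding up a fractional algorithm *)

Section boost.
Context {R : realType} {n : nat} (P : set 'rV[R]_n).
Hypothesis polP : scheduling_polytope P.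
Notation mu := (@lebesgue_measure R).
Implicit Types (I : instance R n) (t s k : R) (j : 'I_n).

(** [B] is simulated to the end; a job is dropped from the real schedule once [k] times its
    simulated volume reaches its size. *)
Definition boost k (B : algorithm R n) : algorithm R n := fun I t =>
  \row_j (if arrived I t j &&
             (k * \int[mu]_(u in `[release I j, t]) B I u 0 j < job_size I j)
          then k * B I t 0 j else 0).

Lemma boost_online k B : online B -> online (boost k B).
Proof.
move=> onB t I I' ag; apply/rowP => j; rewrite !mxE; have [<- H] := ag j.
have [tj|//] := boolP (arrived I t j); have [<- <- _] := H tj.
rewrite (onB t I I' ag).
suff -> : \int[mu]_(u in `[release I j, t]) B I u 0 j =
  \int[mu]_(u in `[release I j, t]) B I' u 0 j by [].
apply: eq_Rintegral => u; rewrite inE/= in_itv/= => /andP[_ ut].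
by rewrite (onB u I I')//; exact: agree_upto_le ag.
Qed.

Variables (k s : R) (B : algorithm R n) (I : instance R n).
Hypotheses (k1 : 1 < k) (s0 : 0 < s) (fB : feasible P s I (B I)).
Let k0 : 0 < k. Proof. exact: lt_trans k1. Qed.
Let pB := feasible_proper fB.

Lemma boost_completion j : j \in jobs I ->
  exists2 t0, release I j <= t0 & [/\
    has_integral `[release I j, t0[%classic (fun t => B I t 0 j) (job_size I j / k),
    has_integral `[t0, +oo[%classic (fun t => B I t 0 j)
      (job_size I j - job_size I j / k) &
    forall t, boost k B I t 0 j =
      if release I j <= t < t0 then k * B I t 0 j else 0].
Proof.
move=> jI; have [_ _ _ /(_ j jI) Bj] := fB.
set r := release I j in Bj *; set p := job_size I j in Bj *.
have p0 : 0 < p by exact: job_size_gt0.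
have B0 t : 0 <= B I t 0 j by exact: vle_ge0 (proper_ge0 polP (ltW s0) pB t).
have mB (D : set R) : measurable D -> measurable_fun D (fun t => B I t 0 j).
  by move=> mD; exact: (proper_rates pB mD).1.
have hB := ge0_has_integral (mB _ (measurable_itv `[r, +oo[)) (fun t _ => B0 t) Bj.
pose F t := \int[mu]_(u in `[r, t[) B I u 0 j.
have hF t : has_integral `[r, t[%classic (fun t => B I t 0 j) (F t).
  have [c hc] := proper_window polP (ltW s0) pB r t j.
  by rewrite /F hc.2.
have FE t : \int[mu]_(u in `[r, t]) B I u 0 j = F t.
  by rewrite /F Rintegral_itv_bndo_bndc//; case: (hF t).
have pk0 : 0 < p / k by rewrite divr_gt0.
have pkp : 0 < p - p / k.
  by rewrite subr_gt0 ltr_pdivrMr// -[ltLHS]mulr1 ltr_pM2l.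
have [T rT Ttail] := has_integral_tail pkp (fun t _ => B0 t) hB.
(* A bound on the rates is a Lipschitz constant of the processed volume; adding 1 makes it
   positive. *)
pose M := s * support_fun P (const_mx 1) + 1.
have M0 : 0 < M.
  by rewrite ltr_wpDl// mulr_ge0//; [exact: ltW|exact: support_ge0].
have FL t u : r <= t -> t <= u -> F t <= F u <= F t + M * (u - t).
  move=> rt tu.
  have b1 : (BLeft r <= BLeft t)%O by rewrite bnd_simp.
  have b2 : (BLeft t <= BLeft u)%O by rewrite bnd_simp.
  have [a [b [ha hb FuE]]] := has_integral_split b1 b2 (hF u).
  rewrite FuE (has_integral_unique ha (hF t)) lerDl lerD2l.
  apply/andP; split; first by apply: has_integral_ge0 hb _.
  apply: (le_has_integral (measurable_itv _) hb (has_integral_cst M tu)) => v _.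
  apply: (@le_trans _ _ (s * support_fun P (const_mx 1))); last by rewrite lerDl.
  exact: (rates_le polP j (ltW s0) pB.1 (Logic.I : [set: R] v)).
have Fr : F r < p / k by rewrite /F set_itv_ge ?bnd_simp ?ltxx// Rintegral_set0.
have FT : p / k <= F T.
  have b1 : (BLeft r <= BLeft T)%O by rewrite bnd_simp ltW.
  have b2 : (BLeft T <= +oo)%O by [].
  have [a [b [ha hb pE]]] := has_integral_split b1 b2 hB.
  by have := Ttail b hb; rewrite (has_integral_unique (hF T) ha); lra.
have [t0 rt0 [Ft0 tt0]] := lipschitz_crossing (ltW rT) M0 FL Fr FT.
exists t0 => //; split.
- by rewrite -Ft0.
- have b1 : (BLeft r <= BLeft t0)%O by rewrite bnd_simp.
  have b2 : (BLeft t0 <= +oo)%O by [].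
  have [a [b [ha hb pE]]] := has_integral_split b1 b2 hB.
  rewrite (_ : p - p / k = b)//.
  by have := has_integral_unique ha (hF t0); rewrite Ft0; lra.
- move=> t; rewrite mxE /arrived jI/= -/r -/p FE.
  have [rt|//] := boolP (r <= t); rewrite /= tt0//.
  by rewrite ltr_pdivlMr// mulrC.
Qed.

Lemma boost_feasible s' : k * s <= s' -> feasible P s' I (boost k B I).
Proof.
move=> ks; have s'0 : 0 < s' by apply: lt_le_trans ks; rewrite mulr_gt0.
have B0 t : vle 0 (B I t) by exact: (proper_ge0 polP (ltW s0) pB t).
have mBst j : measurable_fun [set: R] (fun t => B I t 0 j) by case: fB.
have boost0 j : j \notin jobs I -> forall t, boost k B I t 0 j = 0.
  by move=> jI t; rewrite mxE /arrived (negbTE jI).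
split.
- move=> j; have [jI|/boost0 H] := boolP (j \in jobs I); last first.
    by apply: eq_measurable_fun (measurable_cst (0 : R)) => t _; rewrite H.
  have [t0 rt0 [_ _ bE]] := boost_completion jI.
  have mb : measurable_fun [set: R] (fun t => release I j <= t < t0).
    by apply: measurable_and; [exact: measurable_fun_ler|exact: measurable_fun_ltr].
  rewrite (_ : (fun t => _) =
      fun t => if release I j <= t < t0 then k * B I t 0 j else 0).
    by apply: measurable_fun_ifT => //; exact: measurable_funM.
  by apply/funext => t; rewrite bE.
- move=> t; have [z Pz BE] : exists2 z, P z & B I t = s *: z by case: fB.
  exists (s'^-1 *: boost k B I t); last by rewrite scalerA divff ?scale1r// gt_eqF.
  have zge0 j : 0 <= z 0 j by apply: vle_ge0; exact: (polytope_ge0 polP).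
  apply: (polytope_down polP _ _ Pz).
    apply/vle0P => j; rewrite mxE; apply: mulr_ge0; first by rewrite invr_ge0 ltW.
    rewrite mxE; case: ifP => // _.
    by rewrite mulr_ge0//; [exact: ltW|exact: vle_ge0].
  move=> j; rewrite mxE ler_pdivrMl// mxE.
  case: ifP => _; last by rewrite mulr_ge0// ltW.
  by rewrite BE mxE mulrA ler_wpM2r.
- by move=> t j tj; rewrite mxE (negbTE tj).
- move=> j jI; have [t0 rt0 [h1 h2 bE]] := boost_completion jI.
  have b1 : (BLeft (release I j) <= BLeft t0)%O by rewrite bnd_simp.
  have b2 : (BLeft t0 <= +oo)%O by [].
  rewrite (_ : job_size I j = k * (job_size I j / k) + 0); last first.
    by rewrite addr0 mulrC divfK// gt_eqF.
  apply: has_integralE => //; apply: (has_integral_cat b1 b2).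
    apply: eq_has_integral (has_integralZ _ k h1) => // t /in_itvco tt0.
    by rewrite bE tt0.
  apply: eq_has_integral (has_integral0 _) => // t /in_itvcy tt0.
  by rewrite bE [t < t0]ltNge tt0 andbF.
Qed.

(** Job by job, [k / (k - 1)] is the inverse of the fraction [1 - k^-1] of the job that [B]
    processes only from the boosted completion time on. *)
Lemma boost_integral_flow :
  (integral_flow I (boost k B I) <= (k / (k - 1))%:E * fractional_flow I (B I))%E.
Proof.
have B0 t j : 0 <= B I t 0 j by exact: vle_ge0 (proper_ge0 polP (ltW s0) pB t).
have flow0 j t : j \in jobs I -> release I j <= t ->
    0 <= weight I j / job_size I j * (t - release I j) * B I t 0 j.
  move=> jI jt; rewrite mulr_ge0// mulr_ge0 ?subr_ge0//.
  by rewrite divr_ge0 ?weight_ge0// ltW// job_size_gt0.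
rewrite /fractional_flow ge0_sume_distrr; last first.
  move=> j jI; apply: integral_ge0 => t /in_itvcy jt.
  by rewrite lee_fin flow0.
apply: lee_sum => j jI; have [t0 rt0 [h1 h2 bE]] := boost_completion jI.
set r := release I j in rt0 h1 h2 bE flow0 *; set p := job_size I j in h1 h2 flow0 *.
set w := weight I j in flow0 *.
have p0 : 0 < p by exact: job_size_gt0.
have w0 : 0 <= w by exact: weight_ge0.
have km1 : 0 < k - 1 by rewrite subr_gt0.
have Ct0 : (completion_time I (boost k B I) j <= t0%:E)%E.
  apply: ereal_inf_lbound; exists t0 => //; split=> //.
  have hA : has_integral `[r, t0[%classic (fun t => boost k B I t 0 j) (k * (p / k)).
    apply: eq_has_integral (has_integralZ _ k h1) => // t /in_itvco tt0.
    by rewrite bE tt0.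
  have := has_integralE _ hA; rewrite integral_itv_bndo_bndc => [->//|].
    by rewrite mulrC divfK// gt_eqF.
  by apply/measurable_EFinP; exact: has_integral_measurable hA.
have lo : ((w * (t0 - r) * (1 - k^-1))%:E <=
    \int[mu]_(t in `[r, +oo[) (w / p * (t - r) * B I t 0%R j)%:E)%E.
  have mF (D : set R) : measurable D ->
      measurable_fun D (fun t => w / p * (t - r) * B I t 0 j).
    move=> mD; apply: measurable_funM; last exact: (proper_rates pB mD).1.
    by apply: measurable_funM => //; apply: measurable_funTS; exact: measurable_funB.
  have wp0 : 0 <= w / p by rewrite divr_ge0// ltW.
  apply: (@le_trans _ _ (\int[mu]_(t in `[t0, +oo[) (w / p * (t - r) * B I t 0%R j)%:E)%E); last first.
    apply: ge0_subset_integral => //.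
    - by apply/measurable_EFinP; exact: mF.
    - by move=> t /in_itvcy rt; rewrite lee_fin flow0.
    - by move=> t /in_itvcy tt; apply/in_itvcy; exact: le_trans tt.
  have hc := has_integralZ (measurable_itv _) (w / p * (t0 - r)) h2.
  have -> : w * (t0 - r) * (1 - k^-1) = w / p * (t0 - r) * (p - p / k).
    by field; rewrite !gt_eqF.
  rewrite -(has_integralE _ hc)//; apply: ge0_le_integral => //.
  - move=> t _; rewrite lee_fin mulr_ge0// mulr_ge0// subr_ge0//.
  - by apply/measurable_EFinP; exact: has_integral_measurable hc.
  - by apply/measurable_EFinP; exact: mF.
  - move=> t /in_itvcy tt; rewrite lee_fin ler_wpM2r// ler_wpM2l//.
    by rewrite lerD2r.
apply: (@le_trans _ _ (w * (t0 - r))%:E).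
  rewrite EFinM; apply: lee_wpmul2l; first by rewrite lee_fin.
  by rewrite EFinB; apply: leeB.
have kk0 : 0 <= k / (k - 1) by rewrite divr_ge0// ltW.
apply: le_trans (lee_wpmul2l _ lo); last by rewrite lee_fin.
rewrite -EFinM lee_fin.
suff -> : k / (k - 1) * (w * (t0 - r) * (1 - k^-1)) = w * (t0 - r) by [].
by field; rewrite !gt_eqF.
Qed.

End boost.

(** * Assembling the competitive ratios *)

Section competitiveness.
Context {R : realType} {n : nat} (P : set 'rV[R]_n).

Lemma competitive_intro (obj : instance R n -> schedule R n -> \bar R) (s c : R)
    (A : algorithm R n) : 0 < c ->
    (forall I, feasible P s I (A I)) ->
    (forall I O, feasible P 1 I O -> (obj I (A I) <= c%:E * obj I O)%E) ->
  competitive obj P s c A.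
Proof.
move=> c0 fA AO I; split; first exact: fA.
rewrite -lee_pdivrMl//; apply: le_ereal_inf_tmp => _ [Z fZ <-].
by rewrite lee_pdivrMl// AO.
Qed.

Lemma fractional_flow_ge0 (s : R) I Z : scheduling_polytope P -> 0 <= s ->
  feasible P s I Z -> (0 <= fractional_flow I Z)%E.
Proof.
move=> polP s0 fZ; apply: sume_ge0 => j jI; apply: integral_ge0 => t /in_itvcy jt.
rewrite lee_fin mulr_ge0//.
  by rewrite mulr_ge0 ?subr_ge0// divr_ge0 ?weight_ge0// ltW// job_size_gt0.
exact: vle_ge0 (proper_ge0 polP s0 (feasible_proper fZ) t).
Qed.

End competitiveness.

Theorem theorem3p3 (R : realType) :
  exists2 C : R, 0 < C &
    forall (n : nat) (P : set 'rV[R]_n),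
      scheduling_polytope P ->
      residual_attained P ->
      (forall c : 'rV[R]_n, vle 0 c -> linear_substitute (rate_value P c)) ->
      forall eps : R, 0 < eps ->
        [/\ exists2 A : algorithm R n, online A & gd_algorithm P (1 + eps) A,
            forall A : algorithm R n, gd_algorithm P (1 + eps) A ->
              competitive fractional_flow P (1 + eps) (C / Num.min 1 eps) A
          & exists2 A : algorithm R n, online A &
              competitive integral_flow P (1 + eps)
                (C / Num.min 1 eps ^+ 2) A].
Proof.
(* Dictated by the integral part: with [a = m / 3] its ratio [(1 + a) * (2 + a) / a ^+ 2] is at most
   [4 / a ^+ 2 = 36 / m ^+ 2]. The fractional ratio [(2 + eps) / eps] is at most [3 / m]. *)
exists 36 => // n P polP attP lsP eps eps0.
set m := Num.min 1 eps.
have m0 : 0 < m by rewrite lt_min ltr01 eps0.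
have m1 : m <= 1 by rewrite ge_min lexx.
have meps : m <= eps by rewrite ge_min lexx orbT.
have s0 : 0 < 1 + eps by rewrite addr_gt0.
split.
- exists (gd_run P (1 + eps)); first exact: gd_iter_online.
  by move=> I; exact: gd_run_gradient_descent.
- move=> A gdA; apply: competitive_intro => [|I|I O fO].
  + by rewrite divr_gt0.
  + by have [fA _] := gd_feasible polP attP eps0 (gdA I).
  + apply: le_trans (gd_fractional_flow polP attP lsP eps0 (gdA I) fO) _.
    apply: lee_wpmul2r; first exact: fractional_flow_ge0 polP ler01 fO.
    rewrite lee_fin ler_pdivrMr// mulrAC ler_pdivlMr//.
    have := ler_wpM2l (ltW eps0) m1; rewrite mulr1 mulrDl; lra.
(* Gradient descent and the boost each use a factor [1 + a] of speed, and
   [(1 + a) * (1 + a) <= 1 + 3 * a = 1 + m] since [a <= 1]. *)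
- pose a := m / 3; have a0 : 0 < a by rewrite divr_gt0.
  have a1 : a <= 1 / 3 by rewrite ler_pdivrMr// divfK.
  have k1 : 1 < 1 + a by rewrite ltrDl.
  have sa0 : 0 < 1 + a by rewrite addr_gt0.
  have ks : (1 + a) * (1 + a) <= 1 + eps.
    have : 3 * a = m by rewrite /a; field.
    by nra.
  pose B : algorithm R n := gd_run P (1 + a).
  have gdB I : gradient_descent P (1 + a) I (B I) by exact: gd_run_gradient_descent.
  have fB I : feasible P (1 + a) I (B I).
    by have [fA _] := gd_feasible polP attP a0 (gdB I).
  exists (boost (1 + a) B).
    by apply: boost_online; exact: gd_iter_online.
  apply: competitive_intro => [|I|I O fO].
  + by rewrite divr_gt0// exprn_gt0.
  + exact: boost_feasible ks.
  + apply: le_trans (boost_integral_flow polP k1 sa0 (fB I)) _.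
    have c0 : 0 <= (1 + a) / (1 + a - 1) by rewrite divr_ge0//; lra.
    have c1 : 0 <= (2 + a) / a by rewrite divr_ge0//; lra.
    apply: (@le_trans _ _ (((1 + a) / (1 + a - 1))%:E *
        (((2 + a) / a)%:E * integral_flow I O))%E).
      apply: lee_wpmul2l; first by rewrite lee_fin.
      apply: le_trans (gd_fractional_flow polP attP lsP a0 (gdB I) fO) _.
      apply: lee_wpmul2l; first by rewrite lee_fin.
      exact: (fractional_le_integral polP ler01 fO).
    rewrite muleA -EFinM; apply: lee_wpmul2r.
      apply: le_trans (fractional_le_integral polP ler01 fO).
      exact: fractional_flow_ge0 polP ler01 fO.
    have -> : m = 3 * a by rewrite /a; field.
    rewrite lee_fin addrAC subrr add0r mulf_div ler_pdivrMr ?mulr_gt0//.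
    have -> : 36 / (3 * a) ^+ 2 * (a * a) = 4 by field; rewrite gt_eqF.
    by nra.
Qed.
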